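(* Let $n\geq 3$ and let $\Lambda\subset\mathbb{P}^n$ be the union of $l$ generic lines. Then: i) $\Lambda$ is feasible in the following cases: - $n=3$ and $l\leq 6$; - $n>3$ and $l\leq\lfloor \frac{n}{2}\rfloor+2$; ii) $\Lambda$ is non-feasible in the following cases: - $n=3$ and $l\geq 7$; - $n=5$ and $l\geq 6$; - $n=7$ and $l\geq 7$; - $n>3$, $n\neq 5$, $n\neq 7$ and $l\geq\lfloor \frac{n}{2}\rfloor+3$.
   Context: Work over $\mathbb{C}$. A union $\Lambda=\Lambda_1\cup\dots\cup\Lambda_l\subset\mathbb{P}^n$ of lines is feasible if there exists a rational normal curve $\mathcal{C}\subset\mathbb{P}^n$ (a curve projectively equivalent to the degree $n$ Veronese embedding of $\mathbb{P}^1$) such that the scheme $\mathcal{C}\cap\Lambda_i$ has degree $2$ for every $i$; otherwise it is non-feasible. ''Generic'' means that the $l$-tuple of lines is chosen in a suitable non-empty Zariski open subset of the $l$-fold product of the Grassmannian of lines in $\mathbb{P}^n$. *)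

(* Defs.v *)
From HB Require Import structures.
From mathcomp Require Import all_boot all_order all_algebra.
From mathcomp Require Import reals complex.
From mathcomp Require Import mpoly.

Set Implicit Arguments.
Unset Strict Implicit.
Unset Printing Implicit Defensive.

Import GRing.Theory.
Local Open Scope ring_scope.

(* A set of points of P^n is encoded by the set of its homogeneous coordinate
   vectors, i.e. by a predicate on nonzero row vectors which is invariant under
   nonzero scalars. *)
Definition pset (F : fieldType) (n : nat) := 'rV[F]_n.+1 -> Prop.

(* The Grassmannian of lines in P^n: 2-dimensional subspaces of F^(n+1). *)
Definition line (F : fieldType) (n : nat) :=
  {L : {vspace 'rV[F]_n.+1} | \dim L == 2%N}.

Definition line_points (F : fieldType) (n : nat) (L : line F n) : pset F n :=
  fun x => x != 0 /\ x \in val L.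

Definition veronese (F : fieldType) (n : nat) (s t : F) : 'rV[F]_n.+1 :=
  \row_i (s ^+ (n - i) * t ^+ i).

Definition is_rational_normal_curve (F : fieldType) (n : nat) (C : pset F n) :=
  exists2 g : 'M[F]_n.+1, g \in unitmx &
    forall x, C x <-> exists s t c : F,
      [/\ (s, t) != (0, 0), c != 0 & x = c *: (veronese n s t *m g)].

(* Degree-d part of the homogeneous ideal of X. *)
Definition ideal_part (F : fieldType) (n d : nat) (X : pset F n)
    (f : dhomog n.+1 F d) :=
  forall x, X x -> (f : {mpoly F[n.+1]}).@[x 0] = 0.

(* X and Y carry their reduced structure, so the scheme X /\ Y is cut out by
   the homogeneous ideal I(X) + I(Y).  It is finite of degree k when its
   Hilbert polynomial is the constant k, i.e. when (I(X) + I(Y))_d has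
   codimension k in the space of all forms of degree d, for all d >> 0. *)
Definition scheme_inter_degree (F : fieldType) (n : nat) (X Y : pset F n)
    (k : nat) :=
  exists d0 : nat, forall d : nat, (d0 <= d)%N ->
    exists2 U : {vspace dhomog n.+1 F d},
      forall f, f \in U <->
        exists p q, [/\ ideal_part X p, ideal_part Y q & f = p + q] &
      (\dim U + k)%N = \dim {: dhomog n.+1 F d}%VS.

Definition feasible (F : fieldType) (n l : nat) (L : 'I_l -> line F n) :=
  exists2 C : pset F n, is_rational_normal_curve C &
    forall i, scheme_inter_degree C (line_points (L i)) 2.

(* Plücker coordinates on the l-fold product of the Grassmannian: (a, (i, j))
   with i < j indexes the (i, j) coordinate on the a-th factor. *)
Definition pluecker_index (l n : nat) : finType :=
  ('I_l * {ij : 'I_n.+1 * 'I_n.+1 | (ij.1 < ij.2)%N})%type.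

(* Plücker coordinates are computed in the basis [vbasis] of each line; another
   basis rescales them factor by factor, which does not affect the vanishing
   of multihomogeneous polynomials. *)
Definition pluecker (F : fieldType) (n l : nat) (L : 'I_l -> line F n)
    (k : pluecker_index l n) : F :=
  let u := (vbasis (val (L k.1)))`_0 in
  let v := (vbasis (val (L k.1)))`_1 in
  let i := (val k.2).1 in
  let j := (val k.2).2 in
  u 0 i * v 0 j - u 0 j * v 0 i.

Definition pluecker_poly (F : fieldType) (n l : nat) :=
  {mpoly F[#|pluecker_index l n|]}.

Definition multihomogeneous (F : fieldType) (n l : nat)
    (f : pluecker_poly F n l) :=
  exists e : 'I_l -> nat, forall m, m \in msupp f ->
    forall a, (\sum_(k | (enum_val k).1 == a) m k)%N = e a.

(* Zariski topology induced by the Plücker-Segre embedding: closed sets are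
   the common zero loci of families of multihomogeneous polynomials. *)
Definition zariski_open (F : fieldType) (n l : nat)
    (U : ('I_l -> line F n) -> Prop) :=
  exists S : pluecker_poly F n l -> Prop,
    (forall f, S f -> multihomogeneous f) /\
    (forall L, U L <->
       exists2 f, S f & f.@[fun k => pluecker L (enum_val k)] != 0).

Definition generically (F : fieldType) (n l : nat)
    (P : ('I_l -> line F n) -> Prop) :=
  exists U : ('I_l -> line F n) -> Prop,
    [/\ zariski_open U, exists L, U L & forall L, U L -> P L].

(* Main.v *)
Require Import Defs.
From HB Require Import structures.
From mathcomp Require Import all_boot all_order all_algebra.
From mathcomp Require Import all_field.
From mathcomp Require Import reals complex.
From mathcomp Require Import mpoly ring zify.

(* A line meets a rational normal curve in a scheme of degree 2 exactly when it
   is a chord or a tangent, so the feasible l-tuples of lines are the images of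
   a polynomial map whose source consists of a projectivity and l pairs of
   points of the projective line.

   Infeasibility is a dimension count on this map, modulo reparametrisations of
   the curve. The count fails for n = 4 and l = 5; there each chord imposes one
   condition on the six quadrics through the curve, so that some quadric contains
   the five chords, whereas five generic lines of P^4 lie on no quadric.

   Feasibility: by quantifier elimination the image either lies in a hypersurface
   or contains a nonempty open set, and the first case is excluded by exhibiting
   a point where the differential is surjective. A covector killing the
   differential amounts to polynomials of degree at most n, one for each end p of
   each chord, vanishing doubly at p and simply at the other end. Summing over
   the chords through p gives polynomials Lambda_p such that
   sum_p p^i Lambda_p = 0 for i <= n. If there are at most n + 4 points p, then
   Lambda_p = r_p (t - p)^2 S for a common S of degree at most n - 2, and the
   remaining zeros force S = 0. For n > 3 the chords are taken with distinct ends;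
   for n = 3 they are the six edges of a hexagon inscribed in the twisted cubic. *)

Set Implicit Arguments.
Unset Strict Implicit.
Unset Printing Implicit Defensive.

Import Order.TTheory GRing.Theory Num.Theory.
Local Open Scope ring_scope.

(** * Polynomial functions *)

Section PolynomialFunctions.

Variable F : numClosedFieldType.

(** The dimension count succeeds exactly when (n - 2)(2l - n - 4) > 6. At l = floor(n/2) + 3 the
    second factor is 2 for even n and 1 for odd n, so the count works for even n >= 6 and odd n >=
    9. This is the origin of the separate bounds for n = 3, 5, 7 and of the exceptional case n = 4.
    For feasibility, n + 1 vanishing moments on n + 4 nodes leave a three-dimensional space of
    weights, just enough for the square (t - p)^2 to appear; disjoint ends then need 2l <= n + 4,
    that is l <= floor(n/2) + 2. For n = 3 this would allow only three chords, so ends must be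
    shared to reach six. Two translations shape the rest. The degree of an intersection is given by
    Hilbert functions, so chords and tangents have to be recognised from the restrictions to the
    line of the quadrics through the curve. Genericity is expressed by multihomogeneous polynomials
    in Plücker coordinates, whereas the chord map produces a basis of each line; nonvanishing
    conditions are therefore found on bases and then descended to the Grassmannian. *)

Definition polyfun (K : finType) (f : (K -> F) -> F) :=
  exists p : {mpoly F[#|K|]}, forall x, f x = p.@[fun i => x (enum_val i)].

Lemma polyfun_ext (K : finType) (f g : (K -> F) -> F) :
  f =1 g -> polyfun f -> polyfun g.
Proof. by move=> fg [p fp]; exists p => x; rewrite -fg. Qed.

Lemma polyfun_eq (K : finType) (f : (K -> F) -> F) x y :
  polyfun f -> x =1 y -> f x = f y.
Proof. by move=> [p fp] xy; rewrite !fp; apply: meval_eq => i. Qed.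

Lemma polyfun_const (K : finType) (c : F) : polyfun (fun _ : K -> F => c).
Proof. by exists c%:MP => x; rewrite mevalC. Qed.

Lemma polyfun_coord (K : finType) (k : K) : polyfun (fun x : K -> F => x k).
Proof. by exists 'X_(enum_rank k) => x; rewrite mevalXU enum_rankK. Qed.

Lemma polyfun_add (K : finType) (f g : (K -> F) -> F) :
  polyfun f -> polyfun g -> polyfun (fun x => f x + g x).
Proof. by move=> [p fp] [q gq]; exists (p + q) => x; rewrite mevalD fp gq. Qed.

Lemma polyfun_opp (K : finType) (f : (K -> F) -> F) :
  polyfun f -> polyfun (fun x => - f x).
Proof. by move=> [p fp]; exists (- p) => x; rewrite mevalN fp. Qed.

Lemma polyfun_mul (K : finType) (f g : (K -> F) -> F) :
  polyfun f -> polyfun g -> polyfun (fun x => f x * g x).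
Proof. by move=> [p fp] [q gq]; exists (p * q) => x; rewrite mevalM fp gq. Qed.

Lemma polyfun_exp (K : finType) (f : (K -> F) -> F) m :
  polyfun f -> polyfun (fun x => f x ^+ m).
Proof. by move=> [p fp]; exists (p ^+ m) => x; rewrite rmorphXn /= fp. Qed.

Lemma polyfun_sum (K : finType) (I : Type) (r : seq I) (P : pred I)
    (f : I -> (K -> F) -> F) :
  (forall i, polyfun (f i)) -> polyfun (fun x => \sum_(i <- r | P i) f i x).
Proof.
move=> pf; elim: r => [|i r IHr].
  by apply: (polyfun_ext _ (polyfun_const K 0)) => x; rewrite big_nil.
case Pi: (P i).
  apply: (polyfun_ext _ (polyfun_add (pf i) IHr)) => x.
  by rewrite big_cons Pi.
by apply: (polyfun_ext _ IHr) => x; rewrite big_cons Pi.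
Qed.

Lemma polyfun_prod (K : finType) (I : Type) (r : seq I) (P : pred I)
    (f : I -> (K -> F) -> F) :
  (forall i, polyfun (f i)) -> polyfun (fun x => \prod_(i <- r | P i) f i x).
Proof.
move=> pf; elim: r => [|i r IHr].
  by apply: (polyfun_ext _ (polyfun_const K 1)) => x; rewrite big_nil.
case Pi: (P i).
  apply: (polyfun_ext _ (polyfun_mul (pf i) IHr)) => x.
  by rewrite big_cons Pi.
by apply: (polyfun_ext _ IHr) => x; rewrite big_cons Pi.
Qed.

Lemma polyfun_comp (K K' : finType) (f : (K -> F) -> F)
    (g : K -> (K' -> F) -> F) :
  polyfun f -> (forall k, polyfun (g k)) -> polyfun (fun x => f (g^~ x)).
Proof.
move=> [p fp] /fin_all_exists [q gq].
exists (p \mPo [tuple q (enum_val i) | i < #|K|]) => x.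
rewrite comp_mpoly_meval fp; apply: meval_eq => i.
by rewrite tnth_mktuple gq.
Qed.

Lemma polyfun_det (K : finType) m (A : (K -> F) -> 'M[F]_m) :
  (forall i j, polyfun (fun x => A x i j)) -> polyfun (fun x => \det (A x)).
Proof.
move=> pA; rewrite /determinant; apply: polyfun_sum => s.
by apply: polyfun_mul; [apply: polyfun_const|apply: polyfun_prod].
Qed.

(** Induction on the number of variables: [muni] views [p] as a polynomial in the last variable, and
    the other variables are specialised where its leading coefficient does not vanish. *)
Lemma mpoly_neq0_meval n (p : {mpoly F[n]}) :
  p != 0 -> exists x, p.@[x] != 0.
Proof.
elim: n p => [|n IHn] p p0.
  exists (fun=> 0); move: p0; rewrite [p]nvar0_mpolyC mevalC.
  by rewrite mpolyC_eq0.
have up0 : muni p != 0.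
  apply: contra p0 => /eqP up0; apply/eqP/mpolyP => m; rewrite mcoeff0.
  have: (muni p)`_(m ord_max) @_[multinom m (widen_ord (leqnSn n) i) | i < n]
     = 0 by rewrite up0 coef0 mcoeff0.
  rewrite muniE coef_sum raddf_sum /= => <-.
  have Em (m' : 'X_{1..n.+1}) :
     (m == m') = (m ord_max == m' ord_max) &&
       ([multinom m (widen_ord (leqnSn n) i) | i < n] ==
        [multinom m' (widen_ord (leqnSn n) i) | i < n]).
    apply/eqP/andP => [-> //|[/eqP Emax /eqP Ew]]; apply/mnmP => i.
    case: (unliftP ord_max i) => [j ->|-> //].
    have -> : lift ord_max j = widen_ord (leqnSn n) j.
      by apply: val_inj; exact: lift_max.
    by move/mnmP/(_ j): Ew; rewrite !mnmE.
  rewrite [in LHS](mpolyE p) raddf_sum /=; apply: eq_bigr => m' _.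
  rewrite coefZ coefXn mcoeffZ mcoeffX eq_sym Em.
  case: (m ord_max == _) => /=; last by rewrite mulr0n !mulr0 mcoeff0.
  by rewrite mulr1n mulr1 mcoeffZ mcoeffX [in RHS]eq_sym.
pose q := lead_coef (muni p).
have [|x qx] := IHn q; first by rewrite lead_coef_eq0.
pose r : {poly F} := map_poly (meval x) (muni p).
have r0 : r != 0.
  by rewrite -size_poly_gt0 /r size_map_poly_id0 ?size_poly_gt0.
(* In characteristic zero the first [size r] naturals are distinct, one more than the roots that [r]
   can have. *)
have [t rt] : exists t, ~~ root r t.
  have := @max_poly_roots F r [seq i%:R | i <- iota 0 (size r)] r0.
  set s := map _ _; case: (boolP (all (root r) s)) => [_|/allPn[t _ ?] _];
    last by exists t.
  move=> /(_ isT); rewrite map_inj_in_uniq ?iota_uniq.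
    by move=> /(_ isT); rewrite size_map size_iota ltnn.
  by move=> i j _ _ /(mulrIn (oner_neq0 F)).
exists (fun i => oapp x t (unlift ord_max i)).
move: rt; rewrite /root; congr (_ != _).
rewrite /r muniE rmorph_sum horner_sum mevalE; apply: eq_bigr => m _.
rewrite -mul_polyC rmorphM /= map_polyC /= map_polyXn hornerM hornerC hornerXn.
rewrite mevalZ mevalX -mulrA big_ord_recr /= unlift_none /=; congr (_ * (_ * _)).
apply: eq_bigr => i _; rewrite mnmE.
have -> : widen_ord (leqnSn n) i = lift ord_max i.
  by apply: val_inj; exact/esym/lift_max.
by rewrite liftK.
Qed.

End PolynomialFunctions.

(** * Algebraic dependence and quantifier elimination *)

Section AlgebraicDependence.

Variable F : numClosedFieldType.

Lemma msize_prod_exp_le n N D s (P : 'I_N -> {mpoly F[n]}) (e : 'I_N -> nat) :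
  (forall i, msize (P i) <= s)%N -> (forall i, e i <= D)%N ->
  (msize (\prod_i P i ^+ e i) <= N * D * s + 1)%N.
Proof.
move=> Ps eD.
have msize_mul d d' (p q : {mpoly F[n]}) :
    (msize p <= d + 1 -> msize q <= d' + 1 -> msize (p * q) <= d + d' + 1)%N.
  move=> pd qd; have [->|p0] := eqVneq p 0; first by rewrite mul0r msize0.
  have [->|q0] := eqVneq q 0; first by rewrite mulr0 msize0.
  rewrite msizeM //; move: (msize p) (msize q) pd qd => a b.
  by clear; lia.
have msize_exp (p : {mpoly F[n]}) k :
    (msize p <= s -> msize (p ^+ k) <= k * s + 1)%N.
  move=> ps; elim: k => [|k IHk]; first by rewrite expr0 msize1.
  rewrite exprS mulSn; apply: msize_mul => //; lia.
have : (msize (\prod_i P i ^+ e i) <= (\sum_(i < N) D * s) + 1)%N.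
  elim/big_rec2: _ => [|i k p _ IH]; first by rewrite msize1.
  apply: msize_mul => //; apply: leq_trans (msize_exp _ _ (Ps i)) _.
  by rewrite leq_add2r leq_mul2r eD orbT.
by rewrite sum_nat_const card_ord mulnA.
Qed.

(* There are (D+1)^#|K'| products of powers at most D of the phi k; they lie in
   a space of dimension O(D^#|K|), so for D large they are dependent. *)
Lemma polyfun_dependent (K K' : finType) (phi : K' -> (K -> F) -> F) :
  (#|K| < #|K'|)%N -> (forall k, polyfun (phi k)) ->
  exists h : (K' -> F) -> F,
    [/\ polyfun h, exists y, h y != 0 & forall x, h (phi^~ x) = 0].
Proof.
move=> ltK /fin_all_exists [P phiP].
set N := #|K'| in ltK *; set n := #|K| in P phiP ltK *.
pose Q (i : 'I_N) := P (enum_val i).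
pose s := (\max_i msize (Q i))%N.
(* With this [D], the number of monomials is at most ((N s + 1)(D + 1))^n = D (D + 1)^n, which is
   below (D + 1)^(n + 1) and hence below the number of products. *)
pose D := ((N * s + 1) ^ n)%N.
pose B := (N * D * s + 1)%N.
pose I := {ffun 'I_N -> 'I_D.+1}; pose J := {ffun 'I_n -> 'I_B}.
pose M (e : I) := \prod_i Q i ^+ e i.
have ltJI : (#|J| < #|I|)%N.
  rewrite !card_ffun !card_ord -/n -/N.
  apply: (@leq_ltn_trans (((N * s + 1) * D.+1) ^ n)).
    have : (B <= (N * s + 1) * D.+1)%N by rewrite /B; nia.
    by elim: (n) => // k IHk BD; rewrite !expnS leq_mul // IHk.
  rewrite expnMn -/D; apply: (@leq_trans (D.+1 ^ n.+1)).
    by rewrite expnS ltn_pmul2r ?expn_gt0.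
  by rewrite leq_pexp2l.
pose A : 'M[F]_(#|I|, #|J|) := \matrix_(i, j)
  (M (enum_val i))@_[multinom ((enum_val j : J) k : nat) | k < n].
have /rowV0Pn [c /sub_kermxP cA c0] : kermx A != 0.
  rewrite kermx_eq0 -row_leq_rank -ltnNge.
  exact: leq_ltn_trans (rank_leq_col _) ltJI.
have sum0 : \sum_(i < #|I|) c 0 i *: M (enum_val i) = 0.
  apply/mpolyP => m; rewrite mcoeff0 raddf_sum /=.
  under eq_bigr do rewrite mcoeffZ.
  have [/forallP mB | /forallPn [k]] := boolP [forall k, m k < B]%N.
    have := congr1 (fun w : 'rV_ _ => w 0 (enum_rank ([ffun k => Ordinal (mB k)] : J))) cA.
    rewrite [in RHS]mxE mxE => E; rewrite -[RHS]E.
    apply: eq_bigr => i _; rewrite mxE enum_rankK.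
    by congr (_ * _@__); apply/mnmP => k; rewrite mnmE ffunE.
  rewrite -leqNgt => Bk; apply: big1 => i _.
  rewrite (_ : _@_m = 0) ?mulr0 //; apply: memN_msupp_eq0.
  apply: msize_mdeg_ge; apply: leq_trans (leq_trans Bk _).
    apply: msize_prod_exp_le => j; last by rewrite -ltnS.
    exact: leq_bigmax.
  by rewrite mdegE (bigD1 k) //= leq_addr.
pose q : {mpoly F[N]} :=
  \sum_(i < #|I|) c 0 i *: 'X_[[multinom ((enum_val i : I) k : nat) | k < N]].
have q0 : q != 0.
  apply: contraNneq c0 => q0; apply/eqP/rowP => j; rewrite mxE.
  rewrite -[RHS](mcoeff0 _ [multinom ((enum_val j : I) k : nat) | k < N]) -q0.
  rewrite raddf_sum (bigD1 j) //= big1 => [|i /negP ij].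
    by rewrite addr0 mcoeffZ mcoeffX eqxx mulr1.
  rewrite mcoeffZ mcoeffX (_ : _ == _ = false) ?mulr0 //.
  apply/negP => /eqP/mnmP eij; apply: ij; apply/eqP/enum_val_inj/ffunP => k.
  by apply: val_inj; have := eij k; rewrite !mnmE.
exists (fun y => q.@[fun i => y (enum_val i)]); split; first by exists q.
  have [y qy] := mpoly_neq0_meval q0; exists (fun k => y (enum_rank k)).
  by rewrite (meval_eq _ (v2 := y)) // => i; rewrite enum_valK.
move=> x; rewrite -[RHS](@meval0 n F (fun i => x (enum_val i))) -sum0 /q.
rewrite !raddf_sum; apply: eq_bigr => i _ /=; rewrite !mevalZ mevalX /M.
rewrite rmorph_prod; congr (_ * _); apply: eq_bigr => j _.
by rewrite mnmE phiP rmorphXn.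
Qed.

End AlgebraicDependence.

Section GenericTruth.

Variable F : numClosedFieldType.

Let env N (y : 'I_N -> F) : seq F := [seq y i | i <- enum 'I_N].

Let nth_env N (y : 'I_N -> F) (i : 'I_N) : (env y)`_i = y i.
Proof. by rewrite (nth_map i) ?nth_ord_enum // size_enum_ord. Qed.

Let size_env N (y : 'I_N -> F) : size (env y) = N.
Proof. by rewrite size_map size_enum_ord. Qed.

Lemma rterm_mpoly N (t : GRing.term F) : GRing.rterm t ->
  exists p : {mpoly F[N]}, forall y, GRing.eval (env y) t = p.@[y].
Proof.
elim: t => //=.
- move=> i _; have [iN|Ni] := ltnP i N.
    exists 'X_(Ordinal iN) => y; rewrite mevalXU.
    by rewrite -[RHS]nth_env.
  (* Variables of index at least [N] fall outside the environment and read as 0. *)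
  by exists 0 => y; rewrite meval0 nth_default // size_env.
- by move=> c _; exists c%:MP => y; rewrite mevalC.
- by move=> k _; exists k%:R => y; rewrite rmorph_nat.
- move=> t1 IH1 t2 IH2 /andP[/IH1 [p pE] /IH2 [q qE]].
  by exists (p + q) => y; rewrite mevalD pE qE.
- by move=> t IH /IH [p pE]; exists (- p) => y; rewrite mevalN pE.
- by move=> t IH k /IH [p pE]; exists (p *+ k) => y; rewrite mevalMn pE.
- move=> t1 IH1 t2 IH2 /andP[/IH1 [p pE] /IH2 [q qE]].
  by exists (p * q) => y; rewrite mevalM pE qE.
- by move=> t IH k /IH [p pE]; exists (p ^+ k) => y; rewrite rmorphXn /= pE.
Qed.

(** The atoms are polynomial equations, each either an identity or false off the zeros of the
    difference of its sides. Multiplying these exceptional polynomials handles the connectives. *)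
Lemma qf_generic N (f : GRing.formula F) :
  GRing.qf_form f -> GRing.rformula f ->
  exists2 h : {mpoly F[N]}, h != 0 & exists b : bool,
    forall y, h.@[y] != 0 -> GRing.qf_eval (env y) f = b.
Proof.
have pair (op : bool -> bool -> bool) f1 f2 :
    (exists2 h : {mpoly F[N]}, h != 0 & exists b : bool,
       forall y, h.@[y] != 0 -> GRing.qf_eval (env y) f1 = b) ->
    (exists2 h : {mpoly F[N]}, h != 0 & exists b : bool,
       forall y, h.@[y] != 0 -> GRing.qf_eval (env y) f2 = b) ->
    exists2 h : {mpoly F[N]}, h != 0 & exists b : bool, forall y, h.@[y] != 0 ->
      op (GRing.qf_eval (env y) f1) (GRing.qf_eval (env y) f2) = b.
  move=> [h1 h10 [b1 E1]] [h2 h20 [b2 E2]].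
  exists (h1 * h2); first by rewrite mulf_neq0.
  exists (op b1 b2) => y; rewrite mevalM mulf_eq0 negb_or => /andP[y1 y2].
  by rewrite E1 ?E2.
elim: f => //=.
- by move=> b _ _; exists 1; rewrite ?oner_eq0 //; exists b.
- move=> t1 t2 _ /andP[/(rterm_mpoly N)[p1 E1] /(rterm_mpoly N)[p2 E2]].
  have [p12|p12] := eqVneq p1 p2.
    exists 1; rewrite ?oner_eq0 //; exists true => y _.
    by rewrite E1 E2 p12 eqxx.
  exists (p1 - p2); first by rewrite subr_eq0.
  exists false => y; rewrite mevalB subr_eq0 => /negbTE.
  by rewrite E1 E2.
- move=> f1 IH1 f2 IH2 /andP[q1 q2] /andP[r1 r2].
  by apply: (pair andb); [apply: IH1|apply: IH2].
- move=> f1 IH1 f2 IH2 /andP[q1 q2] /andP[r1 r2].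
  by apply: (pair orb); [apply: IH1|apply: IH2].
- move=> f1 IH1 f2 IH2 /andP[q1 q2] /andP[r1 r2].
  by apply: (pair implb); [apply: IH1|apply: IH2].
- move=> f IH q1 r1; have [h h0 [b E]] := IH q1 r1.
  by exists h => //; exists (~~ b) => y /E ->.
Qed.

Lemma mpoly_term N (p : {mpoly F[N]}) (v : 'I_N -> nat) :
  exists2 t : GRing.term F, GRing.rterm t &
    forall e, GRing.eval e t = p.@[fun i => e`_(v i)].
Proof.
elim/mpolyind: p => [|c m p _ _ [t rt tE]].
  by exists (GRing.Const 0) => // e; rewrite meval0.
have [tm rtm tmE] : exists2 t : GRing.term F, GRing.rterm t &
    forall e, GRing.eval e t = \prod_i e`_(v i) ^+ m i.
  elim: (index_enum _) => [|i s [t1 rt1 t1E]].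
    by exists (GRing.Const 1) => // e; rewrite big_nil.
  exists (GRing.Mul (GRing.Exp (GRing.Var _ (v i)) (m i)) t1) => //= e.
  by rewrite big_cons t1E.
exists (GRing.Add (GRing.Mul (GRing.Const c) tm) t) => [|e] /=.
  by rewrite rtm rt.
by rewrite tmE tE mevalD mevalZ mevalX.
Qed.

(* Chevalley's theorem through quantifier elimination: the image is defined by
   a quantifier-free formula, whose truth value is generically constant. *)
Lemma image_dichotomy (K K' : finType) (phi : K' -> (K -> F) -> F)
    (c : (K -> F) -> F) :
  (forall k, polyfun (phi k)) -> polyfun c ->
  exists h : (K' -> F) -> F, [/\ polyfun h, exists y, h y != 0 &
    (forall y, h y != 0 -> exists x, c x != 0 /\ forall k, y k = phi k x) \/
    (forall x, c x != 0 -> h (phi^~ x) = 0)].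
Proof.
move=> /fin_all_exists [P phiP] [pc cE].
set N := #|K'|; set n := #|K|.
(* Variables below [N] are the free coordinates of the target; the next [n] are those of the source
   and get quantified. *)
pose v (i : 'I_n) : nat := (N + i)%N.
have /fin_all_exists2 [t rt tE] : forall i : 'I_N,
    exists2 t : GRing.term F, GRing.rterm t &
    forall e, GRing.eval e t = (P (enum_val i)).@[fun i => e`_(v i)].
  by move=> i; apply: mpoly_term.
have [tc rtc tcE] := mpoly_term pc v.
pose eqs := foldr (@GRing.And F) (GRing.Bool true)
  [seq GRing.Equal (GRing.Var F i) (t i) | i : 'I_N <- enum 'I_N].
pose body := GRing.And (GRing.Not (GRing.Equal tc (GRing.Const 0))) eqs.
have eqsE e : GRing.holds e eqs <-> forall i : 'I_N, e`_i = GRing.eval e (t i).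
  rewrite /eqs; split=> [|H].
    move=> + i; have : i \in enum 'I_N by rewrite mem_enum.
    elim: (enum 'I_N) => //= j s IHs; rewrite inE.
    by case/predU1P=> [-> [] //|/IHs IH [_ /IH]].
  by elim: (enum 'I_N) => //= j s IHs; split.
have reqs : GRing.rformula eqs.
  by rewrite /eqs; elim: (enum 'I_N) => //= j s ->; rewrite rt.
pose f := foldr GRing.Exists body (iota N n).
have rf : GRing.rformula f.
  by rewrite /f; elim: (iota N n) => //=; rewrite rtc reqs.
have holdsE y : GRing.holds (env y) f <->
    exists x, c x != 0 /\ forall k, y (enum_rank k) = phi k x.
  rewrite -GRing.foldExistsP; split.
    case=> e' same [/= cn0 /eqsE eqs_e].
    exists (fun k => e'`_(N + enum_rank k)); split.
      apply/eqP; move: cn0; rewrite tcE cE; congr (_ <> _).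
      by apply: meval_eq => i; rewrite enum_valK.
    move=> k; rewrite -nth_env same ?eqs_e; last first.
      by rewrite !inE mem_iota negb_and -ltnNge ltn_ord.
    rewrite tE enum_rankK phiP; apply: meval_eq => i.
    by rewrite enum_valK.
  case=> x [cx yE]; pose w (i : 'I_n) := x (enum_val i).
  have nthw i : (env y ++ env w)`_(v i) = w i.
    rewrite nth_cat size_env /v ltnNge leq_addr /=.
    by rewrite addKn nth_env.
  have nthy (i : 'I_N) : (env y ++ env w)`_i = y i.
    by rewrite nth_cat size_env ltn_ord nth_env.
  exists (env y ++ env w).
    move=> i; rewrite !inE mem_iota negb_and -ltnNge -leqNgt nth_cat.
    rewrite size_env.
    case: (ltnP i N) => // Ni /= le.
    by rewrite !nth_default ?size_env // leq_subRL.
  split => /=.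
    rewrite tcE; apply/eqP; move: cx; rewrite cE; congr (_ != _).
    by apply: meval_eq => i; rewrite nthw.
  apply/eqsE => i; rewrite nthy tE -[i in LHS]enum_valK yE phiP.
  by apply: meval_eq => j; rewrite nthw.
have clF := @solve_monicpoly F.
pose elim := ClosedFieldQE.ex_elim.
have /andP[qfg rg] :=
  GRing.quantifier_elim_wf (@ClosedFieldQE.wf_ex_elim F) rf.
have [h h0 [b hb]] := qf_generic N qfg rg.
have genE y : h.@[y] != 0 -> GRing.holds (env y) f <-> b.
  move=> /hb <-; apply: rwP.
  exact: GRing.quantifier_elim_rformP (@ClosedFieldQE.wf_ex_elim F)
    (ClosedFieldQE.holds_ex_elim clF) _ _ rf.
exists (fun y => h.@[fun i => y (enum_val i)]); split; first by exists h.
  have [y qy] := mpoly_neq0_meval h0; exists (fun k => y (enum_rank k)).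
  by rewrite (meval_eq _ (v2 := y)) // => i; rewrite enum_valK.
(* If the formula is generically true, generic points lie in the image; if it is generically false,
   no point of the image can avoid the zeros of [h]. *)
case: b {hb} genE => genE; [left|right].
  move=> y /genE [_ /(_ isT)/holdsE[x [cx xE]]]; exists x; split=> // k.
  by rewrite -xE enum_rankK.
move=> x cx; apply/eqP; apply: contraT => /genE [H _].
suff: false by []; apply: H; apply/holdsE; exists x; split=> // k.
by rewrite enum_rankK.
Qed.

End GenericTruth.

(** * Dominance from a surjective differential *)

Section Density.

Variable F : numClosedFieldType.

Lemma poly_horner0 (p : {poly F}) : (forall x, p.[x] = 0) -> p = 0.
Proof.
move=> p0; apply: contraTeq isT => pn0.
have := @max_poly_roots F p [seq i%:R | i <- iota 0 (size p)] pn0.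
rewrite map_inj_in_uniq ?iota_uniq.
  rewrite size_map size_iota ltnn; apply => //.
  by apply/allP => x _; rewrite rootE p0.
by move=> i j _ _ /(mulrIn (oner_neq0 F)).
Qed.

Lemma mmap_horner n (S : 'I_n -> {poly F}) (p : {mpoly F[n]}) x :
  (mmap (@polyC F) S p).[x] = p.@[fun i => (S i).[x]].
Proof.
rewrite /mmap mevalE horner_sum; apply: eq_bigr => m _.
rewrite hornerM hornerC /mmap1 horner_prod; congr (_ * _).
by apply: eq_bigr => i _; rewrite horner_exp.
Qed.

Lemma mmap_homog_scale n (R : comNzRingType) (f : {rmorphism F -> R})
    (c : R) (S : 'I_n -> R) d (p : {mpoly F[n]}) :
  p \is d.-homog -> mmap f (fun i => c * S i) p = c ^+ d * mmap f S p.
Proof.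
move=> /dhomogP hp; rewrite /mmap mulr_sumr; apply: eq_big_seq => m /hp <-.
rewrite mulrCA /mmap1; congr (_ * _).
under eq_bigr do rewrite exprMn.
by rewrite big_split /= mdegE expr_sum.
Qed.

(* Only the lowest degree form of [h] at [y0] matters along the curve [P], and
   it is evaluated at the arbitrary tangent vector [w]. *)
Lemma vanish_of_submersion (K : finType) (h : (K -> F) -> F) (y0 : K -> F) :
  polyfun h ->
  (forall w : K -> F, exists (P : K -> {poly F}) (C : {poly F}),
    [/\ forall k, (P k).[0] = y0 k, forall k, (P k)^`().[0] = w k, C.[0] != 0
      & forall e, C.[e] != 0 -> h (fun k => (P k).[e]) = 0]) ->
  forall y, h y = 0.
Proof.
move=> [p hE] curve y; set n := #|K| in p hE *.
pose H := p \mPo [tuple 'X_i + (y0 (enum_val i))%:MP | i < n].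
have HE z : p.@[fun i => z i + y0 (enum_val i)] = H.@[z].
  rewrite comp_mpoly_meval; apply: meval_eq => i.
  by rewrite tnth_mktuple mevalD mevalXU mevalC.
have [H0|H0] := eqVneq H 0.
  rewrite hE -[RHS](@meval0 n F (fun i => y (enum_val i) - y0 (enum_val i))).
  by rewrite -H0 -HE; apply: meval_eq => i; rewrite subrK.
have exd : exists d, pihomog mdeg d H != 0.
  have := pihomog_partitionE (leqnn (msize H)).
  have [/forallP all0|/forallPn[d dn0] _] :=
    boolP [forall d : 'I_(msize H), pihomog mdeg d H == 0]; last by exists d.
  by rewrite big1 => [/eqP|d _]; [rewrite (negbTE H0)|exact/eqP].
case: (ex_minnP exd) => d Gn0 dmin.
have [w Gw] := mpoly_neq0_meval Gn0.
have [P [C [P0 P1 C0 hC]]] := curve (fun k => w (enum_rank k)).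
have /fin_all_exists[S SE] : forall k, exists S, P k - (y0 k)%:P = 'X * S.
  move=> k; have : root (P k - (y0 k)%:P) 0.
    by rewrite rootE hornerD hornerN hornerC P0 subrr.
  case/factor_theorem=> S SE; exists S.
  by rewrite SE oppr0 addr0 mulrC.
have S0 k : (S k).[0] = w (enum_rank k).
  have := congr1 (fun q : {poly F} => q^`().[0]) (SE k).
  rewrite derivB derivC subr0 P1 => ->.
  by rewrite derivM derivX mul1r hornerD hornerM hornerX mul0r addr0.
pose A d' := mmap (@polyC F) (fun i => S (enum_val i)) (pihomog mdeg d' H).
(* [Q] is [H] along the curve: the component of degree d' evaluated at 'X * S gains the factor
   'X^d'. Hence the coefficient of 'X^d in [Q] is the lowest form of [H] evaluated at the tangent
   vector, which was chosen off its zeros. *)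
pose Q := \sum_(d' < msize H) 'X^d' * A d'.
have Q0 : Q = 0.
  suff : C * Q = 0.
    move/eqP; rewrite mulf_eq0 => /orP[/eqP C00|/eqP //].
    by rewrite C00 horner0 eqxx in C0.
  apply: poly_horner0 => e; rewrite hornerM.
  have [->|/hC] := eqVneq C.[e] 0; first by rewrite mul0r.
  rewrite hE => hP; suff -> : Q.[e] = 0 by rewrite mulr0.
  rewrite -[RHS]hP.
  rewrite (meval_eq _ (v2 := fun i => ('X * S (enum_val i)).[e]
    + y0 (enum_val i))); last first.
    by move=> i; rewrite -SE hornerD hornerN hornerC subrK.
  rewrite HE -mmap_horner [in RHS](pihomog_partitionE (leqnn (msize H))).
  congr (_.[_]); rewrite raddf_sum; apply: eq_bigr => d' _ /=.
  by rewrite (mmap_homog_scale _ _ _ (pihomogP _ _ _)).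
have dH : (d < msize H)%N.
  rewrite ltnNge; apply: contra Gn0 => Hd; apply/eqP.
  rewrite pihomogE big_seq_cond big1 // => m /andP[mH /eqP dm].
  by have := msize_mdeg_lt mH; rewrite dm ltnNge Hd.
have : Q`_d = 0 by rewrite Q0 coef0.
rewrite /Q coef_sum (bigD1 (Ordinal dH)) //= big1 ?addr0.
  rewrite coefXnM ltnn subnn -horner_coef0 mmap_horner => Gw0.
  move: Gw; rewrite -(meval_eq _ (v1 := fun i => (S (enum_val i)).[0])).
    by rewrite Gw0 eqxx.
  by move=> i; rewrite S0 enum_valK.
move=> d' nd; rewrite coefXnM; case: ltnP => // d'd.
have d'd1 : (d' < d)%N by rewrite ltn_neqAle d'd andbT; exact: nd.
suff -> : A d' = 0 by rewrite coef0.
rewrite /A; have [->|/dmin] := eqVneq (pihomog mdeg d' H) 0.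
  by rewrite raddf0.
by rewrite leqNgt d'd1.
Qed.

End Density.

(** * Polynomials with double contact *)

Section DoubleContact.

Variable F : numClosedFieldType.

(** Row rank equals column rank; surjectivity of a differential thus becomes the absence of a
    nonzero covector killing it. *)
Lemma spanning_of_dual (K K' : finType) (b : K -> K' -> F) :
  (forall lam : K' -> F, (forall k, \sum_t b k t * lam t = 0) ->
     forall t, lam t = 0) ->
  forall w : K' -> F, exists v : K -> F, forall t, w t = \sum_k v k * b k t.
Proof.
move=> dual w.
pose B : 'M[F]_(#|K|, #|K'|) := \matrix_(i, j) b (enum_val i) (enum_val j).
have Bfull : row_full B.
  rewrite /row_full -mxrank_tr; change (row_free B^T); rewrite -kermx_eq0.
  apply: contraT => /rowV0Pn[u /sub_kermxP uB] /negP[].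
  apply/eqP/rowP => j; rewrite mxE -[j]enum_valK.
  apply: (dual (fun t => u 0 (enum_rank t))) => k.
  have := congr1 (fun M : 'rV_ _ => M 0 (enum_rank k)) uB.
  rewrite [in RHS]mxE mxE => E; rewrite -[RHS]E.
  rewrite (reindex_onto enum_val enum_rank) /=; last by move=> i _; exact: enum_rankK.
  rewrite (eq_bigl xpredT) => [|i]; last by rewrite enum_valK eqxx.
  by apply: eq_bigr => i _; rewrite !mxE enum_rankK enum_valK mulrC.
have /submxP[v wv] := submx_full (\row_j w (enum_val j)) Bfull.
exists (fun k => v 0 (enum_rank k)) => t.
have := congr1 (fun M : 'rV_ _ => M 0 (enum_rank t)) wv.
rewrite !mxE enum_rankK => ->.
rewrite [RHS](reindex_onto enum_val enum_rank) /=; last by move=> i _; exact: enum_rankK.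
rewrite [RHS](eq_bigl xpredT) => [|i]; last by rewrite enum_valK eqxx.
by apply: eq_bigr => i _; rewrite mxE enum_rankK enum_valK.
Qed.

(* With N_i = sum_k lam_k x_k^i prod_(j != k) ('X - x_j) one has
   N_(i+1) = 'X N_i as long as the i-th moment vanishes. *)
Lemma vanishing_moments n (x : 'I_(n + 4) -> F) (lam : 'I_(n + 4) -> F) :
  (forall i, (i <= n)%N -> \sum_k lam k * x k ^+ i = 0) ->
  (size (\sum_k lam k *: \prod_(j | j != k) ('X - (x j)%:P))%R <= 3)%N.
Proof.
move=> mom.
pose N i : {poly F} := \sum_k (lam k * x k ^+ i) *: \prod_(j | j != k) ('X - (x j)%:P).
have NS i : (i <= n)%N -> N i.+1 = 'X * N i.
  move=> /mom mi; apply/eqP; rewrite eq_sym -subr_eq0 /N mulr_sumr -sumrB.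
  rewrite (eq_bigr (fun k => (lam k * x k ^+ i)%:P * \prod_j ('X - (x j)%:P))).
    by rewrite -mulr_suml -rmorph_sum mi /= mul0r.
  move=> k _; rewrite (bigD1 k (P := predT)) //= -!mul_polyC exprSr !polyCM.
  ring.
have Nn : N n.+1 = 'X^(n.+1) * N 0%N.
  suff H i : (i <= n.+1)%N -> N i = 'X^i * N 0%N by exact: H.
  elim: i => [|i IH] ltin; first by rewrite mul1r.
  by rewrite NS // IH ?exprS ?mulrA // ltnW.
have E0 : N 0%N = \sum_k lam k *: \prod_(j | j != k) ('X - (x j)%:P).
  by apply: eq_bigr => k _; rewrite mulr1.
(* Each product has n + 3 linear factors; dividing by 'X^(n+1) leaves size at most 3. *)
have : (size (N n.+1) <= n + 4)%N.
  apply: (leq_trans (size_sum _ _ _)); apply/bigmax_leqP => k _.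
  apply: (leq_trans (size_scale_leq _ _)).
  rewrite (_ : \prod_(j | j != k) ('X - (x j)%:P) =
    \prod_(j <- enum (predC1 k)) ('X - (x j)%:P)); last by rewrite big_enum.
  by rewrite size_prod_XsubC -cardE cardC1 card_ord addnS.
rewrite Nn -E0; have [->|N0] := eqVneq (N 0%N) 0; first by rewrite size_poly0.
by rewrite mulrC size_mulXn //; lia.
Qed.

(** For each coefficient index c, the moments make the c-th coefficients of the [L k] the values at
    the nodes, up to the weights [r k], of a polynomial of degree at most 2. So L k = r k (A + x_k B
    + x_k^2 S) with [A], [B], [S] independent of k. The double zeros at more nodes than the degrees
    allow then force B = -2 'X S and A = 'X^2 S. *)
Lemma double_contact n (x : 'I_(n + 4) -> F) (L : 'I_(n + 4) -> {poly F}) :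
  injective x -> (forall k, size (L k) <= n.+1)%N ->
  (forall k, (L k).[x k] = 0) -> (forall k, (L k)^`().[x k] = 0) ->
  (forall i, (i <= n)%N -> \sum_k x k ^+ i *: L k = 0) ->
  exists (S : {poly F}) (r : 'I_(n + 4) -> F), [/\ (size S <= n.-1)%N,
    forall k, r k != 0 & forall k, L k = r k *: (('X - (x k)%:P) ^+ 2 * S)].
Proof.
move=> xinj szL L0 L1 mom.
(* The Lagrange weight: at [x k] only the k-th product in [N c] survives. *)
pose r k := (\prod_(j | j != k) (x k - x j))^-1.
have r0 k : r k != 0.
  rewrite invr_eq0; apply/prodf_neq0 => j jk; rewrite subr_eq0.
  by rewrite (inj_eq xinj) eq_sym.
pose N c : {poly F} := \sum_k (L k)`_c *: \prod_(j | j != k) ('X - (x j)%:P).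
have szN c : (size (N c) <= 3)%N.
  apply: vanishing_moments => i /mom /(congr1 (fun p : {poly F} => p`_c)).
  rewrite coef0 coef_sum => E; rewrite -[RHS]E; apply: eq_bigr => k _.
  by rewrite coefZ mulrC.
have NE k c : (L k)`_c = r k * (N c).[x k].
  rewrite horner_sum (bigD1 k) //= [X in _ + X]big1 => [|k' k'k].
    rewrite addr0 hornerZ horner_prod mulrCA (eq_bigr (fun j => x k - x j)).
      by rewrite mulVf ?mulr1 // -invr_eq0; exact: r0.
    by move=> j _; rewrite !hornerE.
  rewrite hornerZ horner_prod (bigD1 k) /=; last by rewrite eq_sym.
  by rewrite hornerXsubC subrr mul0r mulr0.
pose A := \poly_(c < n.+1) (N c)`_0; pose B := \poly_(c < n.+1) (N c)`_1.
pose S := \poly_(c < n.+1) (N c)`_2.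
have LE k : L k = r k *: (A + x k *: B + x k ^+ 2 *: S).
  apply/polyP => c; rewrite coefZ !coefD !coefZ !coef_poly.
  case: ltnP => cn; last by rewrite nth_default ?(leq_trans (szL k)) //; ring.
  rewrite NE (horner_coef_wide _ (szN c)) !big_ord_recr big_ord0 /=; ring.
have vanish (p : {poly F}) m : (m <= n + 4)%N -> (size p <= m)%N ->
    (forall k, p.[x k] = 0) -> p = 0.
  move=> mn szp px; apply: contraTeq isT => p0.
  have := @max_poly_roots F p [seq x k | k : 'I_(n + 4)] p0.
  rewrite map_inj_uniq ?enum_uniq // size_map -cardE card_ord.
  have -> : all (root p) [seq x k | k : 'I_(n + 4)].
    by apply/allP => _ /mapP[k _ ->]; rewrite rootE px.
  by move=> /(_ isT isT); rewrite ltnNge (leq_trans szp mn).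
have szA : (size A <= n.+1)%N by exact: size_poly.
have szB : (size B <= n.+1)%N by exact: size_poly.
have szS : (size S <= n.+1)%N by exact: size_poly.
have rK k y : r k * y = 0 -> y = 0.
  by move/eqP; rewrite mulf_eq0 (negbTE (r0 k)) => /eqP.
have sizeX2 (p : {poly F}) m : (size p <= m -> size ('X * p)%R <= m.+1)%N.
  by move=> pm; apply: leq_trans (size_polyMleq _ _) _; rewrite size_polyX; lia.
have sizeD (p q : {poly F}) m :
    (size p <= m -> size q <= m -> size (p + q)%R <= m)%N.
  by move=> pm qm; rewrite (leq_trans (size_polyD _ _)) // geq_max pm.
have G0 : A + 'X * B + 'X * ('X * S) = 0.
  apply: (vanish _ n.+3); first lia.
    apply: (sizeD _ _ _); last by do 2!apply: (sizeX2 _ _).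
    by apply: (sizeD _ _ _); [rewrite ltnW // ltnW|rewrite ltnW // ltnS sizeX2].
  move=> k; apply: (rK k); rewrite -[RHS](L0 k) LE !hornerE /=.
  by rewrite expr2.
have H0 : B + 'X * S + 'X * S = 0.
  apply: (vanish _ n.+2); first lia.
    by do 2![apply: (sizeD _ _ _); last exact: (sizeX2 _ _)]; exact: ltnW.
  (* Differentiating [G0] treats the variable in front of [B] and [S] as moving, while in [L k] it
     is frozen at [x k]. The difference of the two derivatives at [x k] is B + 2 'X S. *)
  move=> k; have := congr1 (fun p => p^`().[x k]) G0.
  rewrite !derivD !derivM !derivX deriv0 horner0 !mul1r => G1.
  have := L1 k; rewrite LE derivZ !derivD !derivZ hornerZ => /rK L1'.
  rewrite !hornerE /= in L1' G1 *.
  rewrite -[RHS]G1 -[LHS]addr0 -[in LHS]L1'; ring.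
have EB : B = - ('X * S *+ 2).
  by apply/eqP; rewrite -addr_eq0 mulr2n addrA H0.
have EA : A = 'X * ('X * S).
  move: G0; rewrite EB => E; rewrite -[LHS]subr0 -[in LHS]E; ring.
have LS k : L k = r k *: (('X - (x k)%:P) ^+ 2 * S).
  by rewrite LE EA EB -!mul_polyC !polyC_exp; ring.
exists S, r; split=> //.
have [->|S0] := eqVneq S 0; first by rewrite size_poly0.
have k0 : 'I_(n + 4) by rewrite addnS; exact: ord0.
have := szL k0; rewrite LS size_scale // size_mul ?expf_neq0 ?polyXsubC_eq0 //.
by rewrite size_exp_XsubC; move: (size S) => s; clear; lia.
Qed.

End DoubleContact.

(** * Covectors killing the differential of the chord map *)

Section Conormal.

Variable F : numClosedFieldType.

(* A covector annihilating all first order deformations of the chords joining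
   kappa (a, 0) and kappa (a, 1) on the standard rational normal curve. *)
Record conormal n l (kappa : 'I_l * 'I_2 -> 'I_(n + 4))
    (lam : 'I_l * 'I_2 -> {poly F}) : Prop := Conormal {
  conormal_size : forall j, (size (lam j) <= n.+1)%N;
  conormal_root : forall a r s, (lam (a, r)).[(kappa (a, s))%:R] = 0;
  conormal_deriv : forall j, (lam j)^`().[(kappa j)%:R] = 0;
  conormal_moment : forall i, (i <= n)%N ->
    \sum_j (kappa j)%:R ^+ i *: lam j = 0 }.

Let natr_ord_inj m : injective (fun k : 'I_m => k%:R : F).
Proof. by move=> i j /(mulrIn (oner_neq0 F)) /val_inj. Qed.

Let ord2C (r : 'I_2) : exists s : 'I_2, s != r.
Proof. by exists (if r == ord0 then ord_max else ord0); case: r => [[|[]]]. Qed.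

Lemma conormal_double n l (kappa : 'I_l * 'I_2 -> 'I_(n + 4)) lam :
  conormal kappa lam ->
  exists (S : {poly F}) (r : 'I_(n + 4) -> F), [/\ (size S <= n.-1)%N,
    forall k, r k != 0 & forall k,
    \sum_(j | kappa j == k) lam j = r k *: (('X - k%:R%:P) ^+ 2 * S)].
Proof.
case=> szl l0 l1 mom; apply: (double_contact (@natr_ord_inj _)).
- move=> k; apply: (leq_trans (size_sum _ _ _)).
  by apply/bigmax_leqP => j _; exact: szl.
- move=> k; rewrite horner_sum big1 // => -[a r] /eqP <-; exact: l0.
- move=> k; rewrite raddf_sum horner_sum big1 // => j /eqP <-; exact: l1.
move=> i /mom E; rewrite -[RHS]E [in RHS](partition_big kappa predT) //=.
apply: eq_bigr => k _; rewrite scaler_sumr.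
by apply: eq_bigr => j /eqP ->.
Qed.

(** Distinct ends leave at most one term in each sum, so the zero of [lam j] at the other end passes
    to [S]. In all, [S] acquires n + 4 zeros against degree at most n - 2. *)
Lemma conormal_matching n l (kappa : 'I_l * 'I_2 -> 'I_(n + 4)) lam :
  injective kappa -> conormal kappa lam -> forall j, lam j = 0.
Proof.
move=> kinj cn; have [S [r [szS r0 LS]]] := conormal_double cn.
have lamE j : lam j = r (kappa j) *: (('X - (kappa j)%:R%:P) ^+ 2 * S).
  rewrite -LS (eq_bigl (pred1 j)) ?big_pred1_eq // => j'.
  by rewrite (inj_eq kinj).
suff S0 : S = 0 by move=> j; rewrite lamE S0 mulr0 scaler0.
have Sk (k : 'I_(n + 4)) : S.[k%:R] = 0.
  have [/existsP[[a s] /eqP Ek]|/existsPn nk] := boolP [exists j, kappa j == k].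
    have [s' ss'] := ord2C s.
    have := conormal_root cn a s' s; rewrite lamE hornerZ hornerM Ek.
    rewrite horner_exp hornerXsubC => /eqP; rewrite mulf_eq0 (negbTE (r0 _)) /=.
    rewrite mulf_eq0 => /orP[|/eqP //].
    rewrite expf_eq0 subr_eq0 /= (inj_eq (@natr_ord_inj _)).
    by rewrite -Ek (inj_eq kinj) xpair_eqE eqxx /= eq_sym (negbTE ss').
  (* At a node that ends no chord the sum is empty while [r k] is nonzero, so [S] vanishes
     identically. *)
  have := LS k; rewrite big1 => [/esym/eqP|j kj]; last by case/negP: (nk j).
  rewrite scaler_eq0 (negbTE (r0 _)) /= mulf_eq0 expf_eq0 polyXsubC_eq0 /=.
  by move/eqP->; rewrite horner0.
apply: contraTeq isT => S0.
have := @max_poly_roots F S [seq (k : 'I_(n + 4))%:R | k : 'I_(n + 4)] S0.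
rewrite (map_inj_uniq (@natr_ord_inj _)) ?enum_uniq // size_map -cardE card_ord.
have -> : all (root S) [seq (k : 'I_(n + 4))%:R | k : 'I_(n + 4)].
  by apply/allP => _ /mapP[k _ ->]; rewrite rootE Sk.
by move=> /(_ isT isT); move: (size S) szS; clear; lia.
Qed.

Lemma cubic_eq0 (p : {poly F}) u v w : uniq [:: u; v; w] -> (size p <= 4)%N ->
  p.[u] = 0 -> p^`().[u] = 0 -> p.[v] = 0 -> p.[w] = 0 -> p = 0.
Proof.
move=> uvw szp pu pdu pv pw.
have /factor_theorem[q pE] : root p u by apply/rootP.
move: pdu pv pw; rewrite pE derivM derivXsubC mulr1 !hornerE subrr mulr0 add0r.
have [uv uw] : u != v /\ u != w.
  by move: uvw; rewrite /= !inE negb_or => /andP[/andP[]].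
move=> qu /eqP; rewrite mulf_eq0 subr_eq0 [v == u]eq_sym (negbTE uv) orbF.
move=> /eqP qv /eqP; rewrite mulf_eq0 subr_eq0 [w == u]eq_sym (negbTE uw) orbF.
move=> /eqP qw; suff -> : q = 0 by rewrite mul0r.
apply: contraTeq isT => q0.
have := @max_poly_roots F q [:: u; v; w] q0.
rewrite uvw /= !rootE qu qv qw eqxx => /(_ isT isT).
move: szp; rewrite pE size_mul ?polyXsubC_eq0 // size_XsubC.
by move: (size q); clear; lia.
Qed.

(** Edge a joins the vertices a and a + 1 modulo 6. Since n + 4 = 7, node 6 is never an end, and
    this node alone forces S = 0. *)
Definition hexagon l (j : 'I_l * 'I_2) : 'I_7 := inord ((j.1 + j.2) %% 6).

(* At each vertex the two incident edges carry opposite covectors, and each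
   covector also vanishes at the far end of the other edge. *)
Lemma conormal_hexagon l lam : (l <= 6)%N ->
  conormal (n := 3) (@hexagon l) lam -> forall j, lam j = 0.
Proof.
move=> l6 cn; have [S [r [szS r0 LS]]] := conormal_double cn.
have hexE (j : 'I_l * 'I_2) : hexagon j = ((j.1 + j.2) %% 6)%N :> nat.
  by rewrite inordK // (leq_trans (ltn_pmod _ _)).
have S0 : S = 0.
  have := LS ord_max; rewrite big1 => [/esym/eqP|j /eqP/(congr1 val)].
    rewrite scaler_eq0 (negbTE (r0 _)) /= mulf_eq0 expf_eq0 polyXsubC_eq0 /=.
    by move/eqP.
  by rewrite /= hexE => E; have := ltn_pmod (j.1 + j.2) (isT : 0 < 6)%N; rewrite E.
have L0 k : \sum_(j | hexagon j == k) lam j = 0.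
  by rewrite LS S0 mulr0 scaler0.
(* [w] is the far end of the other edge at the vertex (a, s): it is a - 1 = a + 5 when the vertex is
   a, and a + 2 when it is a + 1. With it [lam (a, s)] has a double and two simple zeros, too many
   for a cubic. *)
case=> a s; pose w : 'I_7 := inord ((a + (if s == ord0 then 5 else 2)) %% 6).
have wE : w = ((a + (if s == ord0 then 5 else 2)) %% 6)%N :> nat.
  by rewrite inordK // (leq_trans (ltn_pmod _ _)).
have [s' ss'] := ord2C s.
have a6 : (a < 6)%N := leq_trans (ltn_ord a) l6.
apply: (@cubic_eq0 _ (hexagon (a, s))%:R (hexagon (a, s'))%:R (w : nat)%:R).
- rewrite /= !inE !eqr_nat wE !hexE /=.
  move: (nat_of_ord a) a6 => b b6.
  case: s s' ss' {w wE} => [[|[]]] // ? [[|[]]] // ? /=;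
  by do 6?[case: b b6 => [|b] b6 //].
- exact: conormal_size cn _.
- exact: conormal_root cn _ _ _.
- exact: conormal_deriv cn _.
- exact: conormal_root cn _ _ _.
have := congr1 (fun p => p.[(w : nat)%:R]) (L0 (hexagon (a, s))).
rewrite horner0 (bigD1 (a, s)) //= hornerD horner_sum big1 ?addr0 //.
case=> b t /andP[/eqP/(congr1 val) /=]; rewrite !hexE /= => Ebt.
have b6 : (b < 6)%N := leq_trans (ltn_ord b) l6.
rewrite xpair_eqE => nbt.
suff [t' Ew] : exists t' : 'I_2, w = hexagon (b, t').
  by rewrite Ew; exact: conormal_root cn _ _ _.
have [t' tt'] := ord2C t; exists t'; apply: val_inj; rewrite /= wE hexE /=.
have {}nbt : (b != a :> nat) || (t != s :> nat).
  by rewrite -negb_and.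
move: (nat_of_ord a) (nat_of_ord b) a6 b6 Ebt nbt => a' b' a6 b6.
case: s t t' {ss' s' w wE} tt' => [[|[]]] // ? [[|[]]] // ? [[|[]]] // ? _ /=;
by do 6?[case: a' a6 => [|a'] a6 //]; do 6?[case: b' b6 => [|b'] b6 //].
Qed.

End Conormal.

(** * Generic chords *)

Section GenericChords.

Variable F : numClosedFieldType.
Variables n l : nat.

Definition rowpair_index : finType := ('I_l * 'I_2 * 'I_n.+1)%type.

Definition rowpair (y : rowpair_index -> F) (a : 'I_l) : 'M[F]_(2, n.+1) :=
  \matrix_(r, c) y (a, r, c).

Definition moment_rows (x : 'I_2 -> F) : 'M[F]_(2, n.+1) :=
  \matrix_(j, i) x j ^+ i.

(* Coordinates (a, r, j) of a base change of the a-th line, parameters (a, j)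
   of its two points, entries (i, c) of a projectivity. *)
Let param : finType :=
  ('I_l * 'I_2 * 'I_2 + 'I_l * 'I_2 + 'I_n.+1 * 'I_n.+1)%type.

Let pK (a : 'I_l) (r j : 'I_2) : param := inl (inl (a, r, j)).
Let px (a : 'I_l) (j : 'I_2) : param := inl (inr (a, j)).
Let pG (i c : 'I_n.+1) : param := inr (i, c).

(** The ring is left general because the map is evaluated both at points and along polynomial
    paths. *)
Let chord (R : nzRingType) (t : rowpair_index) (z : param -> R) : R :=
  \sum_j z (pK t.1.1 t.1.2 j) * \sum_(i < n.+1) z (px t.1.1 j) ^+ i * z (pG i t.2).

Let nondeg (z : param -> F) : F :=
  \det (\matrix_(i, c) z (pG i c)) *
  \prod_a (\det (\matrix_(r, j) z (pK a r j)) *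
           (z (px a ord0) - z (px a ord_max))).

Let chord_polyfun t : polyfun (@chord F t).
Proof.
apply: polyfun_sum => j; apply: polyfun_mul; first exact: polyfun_coord.
apply: polyfun_sum => i; apply: polyfun_mul; last exact: polyfun_coord.
by apply: polyfun_exp; exact: polyfun_coord.
Qed.

Let nondeg_polyfun : polyfun nondeg.
Proof.
apply: polyfun_mul.
  apply: polyfun_det => i c.
  by apply: polyfun_ext (polyfun_coord _ (pG i c)) => z; rewrite mxE.
apply: polyfun_prod => a; apply: polyfun_mul.
  apply: polyfun_det => r j.
  by apply: polyfun_ext (polyfun_coord _ (pK a r j)) => z; rewrite mxE.
by apply: polyfun_add; [|apply: polyfun_opp]; apply: polyfun_coord.
Qed.

Variable kappa : 'I_l * 'I_2 -> 'I_(n + 4).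

Let x0 (a : 'I_l) (j : 'I_2) : F := (kappa (a, j))%:R.

Let z0 (k : param) : F :=
  match k with
  | inl (inl (a, r, j)) => (r == j)%:R
  | inl (inr (a, j)) => x0 a j
  | inr (i, c) => (i == c)%:R
  end.

(** Partial derivative at [z0], in the parameter [k], of the coordinate [t] of the chord map. *)
Let tangent (k : param) (t : rowpair_index) : F :=
  match k with
  | inl (inl (a, r, j)) => ((a == t.1.1) && (r == t.1.2))%:R * x0 a j ^+ t.2
  | inl (inr (a, j)) => ((a == t.1.1) && (j == t.1.2))%:R *
      (x0 a j ^+ t.2.-1 *+ t.2)
  | inr (i, c) => (c == t.2)%:R * x0 t.1.1 t.1.2 ^+ i
  end.

Let sum_delta (I : finType) (i : I) (f : I -> F) :
  \sum_j (j == i)%:R * f j = f i.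
Proof.
rewrite (bigD1 i) //= eqxx mul1r big1 ?addr0 // => j /negbTE ->.
by rewrite mul0r.
Qed.

Let sum_delta2 (I J : finType) (i : I) (i' : J) (f : I * J -> F) :
  \sum_p ((p.1 == i) && (p.2 == i'))%:R * f p = f (i, i').
Proof. by rewrite -[RHS]sum_delta; apply: eq_bigr => -[j j'] _. Qed.

Let sum_pair (I J : finType) (f : I * J -> F) :
  \sum_p f p = \sum_i \sum_j f (i, j).
Proof. by rewrite pair_bigA; apply: eq_bigr => -[]. Qed.

Let chord_horner t (z : param -> {poly F}) e :
  (chord t z).[e] = chord t (fun k => (z k).[e]).
Proof.
rewrite horner_sum; apply: eq_bigr => j _; rewrite hornerM horner_sum.
congr (_ * _); apply: eq_bigr => i _.
by rewrite hornerM horner_exp.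
Qed.

Let chord_deriv t (v : param -> F) :
  (chord t (fun k => (z0 k)%:P + 'X * (v k)%:P))^`().[0] =
  \sum_k v k * tangent k t.
Proof.
set Z := fun k => _.
have DM (p q : {poly F}) :
    (p * q)^`().[0] = p^`().[0] * q.[0] + p.[0] * q^`().[0].
  by rewrite derivM hornerD !hornerM.
have DS (I : finType) (p : I -> {poly F}) :
    (\sum_i p i)^`().[0] = \sum_i (p i)^`().[0].
  by rewrite raddf_sum horner_sum.
have DX (p : {poly F}) i :
    (p ^+ i)^`().[0] = p^`().[0] * (p.[0] ^+ i.-1 *+ i).
  by rewrite deriv_exp hornerMn hornerM horner_exp mulrnAr mulrC.
have Z0 k : (Z k).[0] = z0 k.
  by rewrite /Z hornerD hornerM !hornerC hornerX mul0r addr0.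
have Z1 k : (Z k)^`().[0] = v k.
  by rewrite derivD derivM !derivC derivX mulr0 mul1r addr0 add0r hornerC.
clearbody Z; case: t => [[a r] c]; rewrite /chord /= DS.
under [LHS]eq_bigr => j _.
  rewrite DM DS Z0 Z1 horner_sum /=.
  under eq_bigr => i _ do rewrite hornerM horner_exp !Z0 /= mulrC.
  rewrite sum_delta.
  under eq_bigr => i _ do rewrite DM DX horner_exp !Z0 !Z1 /=.
  over.
rewrite big_split /= !big_sumType /= -addrA; congr (_ + _).
  rewrite sum_pair exchange_big; apply: eq_bigr => j _ /=.
  rewrite -[LHS](sum_delta2 a r (fun q => v (pK q.1 q.2 j) * x0 a j ^+ c)).
  apply: eq_bigr => -[a' r'] _ /=; rewrite mulrCA; congr (_ * _).
  by case: eqP => [->|]; rewrite ?mul0r.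
rewrite (eq_bigr (fun j => (j == r)%:R *
    (\sum_(i < n.+1) v (px a j) * (x0 a j ^+ i.-1 *+ i) * (i == c)%:R +
     \sum_(i < n.+1) x0 a j ^+ i * v (pG i c)))); last first.
  by move=> j _; rewrite eq_sym -big_split.
rewrite sum_delta; congr (_ + _).
  rewrite (eq_bigr (fun i => (i == c)%:R *
      (v (px a r) * (x0 a r ^+ i.-1 *+ i)))) => [|i _]; last by rewrite mulrC.
  rewrite sum_delta -[LHS](sum_delta2 a r
    (fun q => v (px q.1 q.2) * (x0 q.1 q.2 ^+ c.-1 *+ c))).
  by apply: eq_bigr => -[a' r'] _ /=; rewrite mulrCA.
rewrite sum_pair; apply: eq_bigr => i _.
rewrite -[LHS](sum_delta c (fun c => x0 a r ^+ i * v (pG i c))).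
by apply: eq_bigr => c' _; rewrite [RHS]mulrC mulrA.
Qed.

Hypothesis conormal0 : forall lam, conormal (F := F) kappa lam ->
  forall j, lam j = 0.
Hypothesis kappa_neq : forall a, kappa (a, ord0) != kappa (a, ord_max).

(** Each row of a covector is read as the coefficients of a polynomial. Base changes then give the
    zeros at both ends, parameters of the ends give the zeros of the derivative, and entries of the
    projectivity give the moments. *)
Let tangent_dual lam : (forall k, \sum_t tangent k t * lam t = 0) ->
  forall t, lam t = 0.
Proof.
move=> lam0; pose L (j : 'I_l * 'I_2) : {poly F} :=
  \sum_(c < n.+1) lam (j, c) *: 'X^c.
have coefL j (c : 'I_n.+1) : (L j)`_c = lam (j, c).
  rewrite coef_sum -[RHS](sum_delta c (fun c' => lam (j, c'))).
  apply: eq_bigr => c' _; rewrite coefZ coefXn mulrC; congr (_%:R * _).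
  by rewrite eq_sym.
suff L0 : forall j, L j = 0.
  by case=> j c; rewrite -coefL L0 coef0.
apply: conormal0; split=> [j|a r s|[a r]|i lein].
- apply: (leq_trans (size_sum _ _ _)); apply/bigmax_leqP => c _.
  apply: (leq_trans (size_scale_leq _ _)); rewrite size_polyXn.
  exact: ltn_ord.
- rewrite -[RHS](lam0 (pK a r s)) sum_pair horner_sum.
  rewrite -[LHS](sum_delta2 a r (fun q => \sum_(c < n.+1)
    (lam (q, c) *: 'X^c).[(kappa (a, s))%:R])).
  apply: eq_bigr => -[a' r'] _; rewrite mulr_sumr; apply: eq_bigr => c _ /=.
  rewrite [a' == a]eq_sym [r' == r]eq_sym -mulrA; congr (_ * _).
  by rewrite hornerZ hornerXn mulrC.
- rewrite -[RHS](lam0 (px a r)) sum_pair raddf_sum horner_sum.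
  rewrite -[LHS](sum_delta2 a r (fun q => \sum_(c < n.+1)
    ((lam (q, c) *: 'X^c)^`()).[(kappa (a, r))%:R])).
  apply: eq_bigr => -[a' r'] _; rewrite mulr_sumr; apply: eq_bigr => c _ /=.
  rewrite [a' == a]eq_sym [r' == r]eq_sym -mulrA; congr (_ * _).
  by rewrite derivZ derivXn hornerZ hornerMn hornerXn mulrC.
apply/polyP => d; rewrite coef0 coef_sum.
have [dn|nd] := ltnP d n.+1; last first.
  apply: big1 => j _; rewrite coefZ coef_sum big1 ?mulr0 // => c _.
  rewrite coefZ coefXn (_ : (d == c) = false) ?mulr0 //.
  by apply/eqP => dc; move: nd; rewrite dc leqNgt ltn_ord.
rewrite -[RHS](lam0 (pG (Ordinal (lein : i < n.+1)%N) (Ordinal dn))).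
rewrite [RHS]sum_pair.
apply: eq_bigr => -[a r] _.
rewrite (eq_bigr (fun c => (c == Ordinal dn)%:R *
    ((kappa (a, r))%:R ^+ i * lam (a, r, c)))) => [|c _].
  by rewrite sum_delta coefZ -coefL.
by rewrite eq_sym mulrA.
Qed.

Let chord_dense h : polyfun h ->
  (forall z, nondeg z != 0 -> h (fun t => chord t z) = 0) -> forall y, h y = 0.
Proof.
move=> ph hchord.
apply: (vanish_of_submersion (y0 := fun t => chord t z0)) => // w.
have [v wv] := spanning_of_dual tangent_dual w.
(* The straight path through [z0] in a direction [v] that the differential sends to [w]. *)
pose Z k : {poly F} := (z0 k)%:P + 'X * (v k)%:P.
have Z0 k : (Z k).[0] = z0 k.
  by rewrite /Z hornerD hornerM !hornerC hornerX mul0r addr0.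
have [pc pcE] := nondeg_polyfun.
exists (fun t => chord t Z), (mmap (@polyC F) (fun i => Z (enum_val i)) pc).
have CE e : (mmap (@polyC F) (fun i => Z (enum_val i)) pc).[e] =
    nondeg (fun k => (Z k).[e]).
  by rewrite mmap_horner pcE.
split=> [t|t||e].
- rewrite chord_horner; apply: eq_bigr => j _; rewrite Z0; congr (_ * _).
  by apply: eq_bigr => i _; rewrite !Z0.
- by rewrite wv chord_deriv.
- rewrite CE /nondeg.
  rewrite (_ : \matrix_(i, c) _ = 1%:M); last first.
    by apply/matrixP => i c; rewrite !mxE Z0.
  rewrite det1 mul1r; apply/prodf_neq0 => a _.
  rewrite (_ : \matrix_(i, c) _ = 1%:M); last first.
    by apply/matrixP => i c; rewrite !mxE Z0.
  rewrite det1 mul1r !Z0 /= subr_eq0 /x0 eqr_nat.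
  exact: kappa_neq.
rewrite CE => /hchord h0; rewrite -[RHS]h0; apply: (polyfun_eq ph) => t.
exact: chord_horner.
Qed.

Lemma generic_chords : exists h : (rowpair_index -> F) -> F,
  [/\ polyfun h, exists y, h y != 0 & forall y, h y != 0 ->
    exists (G : 'M[F]_n.+1) (x : 'I_l -> 'I_2 -> F), G \in unitmx /\
      forall a, x a ord0 != x a ord_max /\
        exists2 K : 'M[F]_2, K \in unitmx &
          rowpair y a = K *m moment_rows (x a) *m G].
Proof.
have [h [ph [y hy] [himg|h0]]] :=
  image_dichotomy chord_polyfun nondeg_polyfun; last first.
  by have := chord_dense ph h0 y => /eqP; rewrite (negbTE hy).
exists h; split=> //; first by exists y.
move=> {hy}y /himg[z [nz yE]].
move: nz; rewrite mulf_eq0 negb_or => /andP[nG /prodf_neq0 nK].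
exists (\matrix_(i, c) z (pG i c)), (fun a j => z (px a j)); split.
  by rewrite unitmxE unitfE.
move=> a; have := nK a isT; rewrite mulf_eq0 negb_or subr_eq0 => /andP[nKa ->].
split=> //; exists (\matrix_(r, j) z (pK a r j)); first by rewrite unitmxE unitfE.
apply/matrixP => r c; rewrite -mulmxA mxE yE mxE; apply: eq_bigr => j _.
rewrite !mxE; congr (_ * _); apply: eq_bigr => i _.
by rewrite !mxE.
Qed.

End GenericChords.

(** * Lines and Pluecker coordinates *)

Lemma ord2_cases (r : 'I_2) : r = 0 \/ r = 1.
Proof. by case: r => [[|[|]]] // r2; [left|right]; apply: val_inj. Qed.

Section Lines.

Variable F : numClosedFieldType.

Lemma polyfun_neq0_mul (K : finType) (f g : (K -> F) -> F) :
  polyfun f -> polyfun g -> (exists x, f x != 0) -> (exists x, g x != 0) ->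
  exists x, f x * g x != 0.
Proof.
move=> [p pE] [q qE] [x fx] [y gy].
have p0 : p != 0 by apply: contraNneq fx => p0; rewrite pE p0 meval0.
have q0 : q != 0 by apply: contraNneq gy => q0; rewrite qE q0 meval0.
have [z] := mpoly_neq0_meval (mulf_neq0 p0 q0).
rewrite mevalM => pq; exists (fun k => z (enum_rank k)); rewrite pE qE.
rewrite (meval_eq (v2 := z)) ?(meval_eq (v2 := z) q) // => i;
by rewrite enum_valK.
Qed.

Variable n : nat.

(** Bases of a line are kept as matrices, so that changing the basis is left multiplication by an
    invertible matrix. *)
Definition spans (L : line F n) (N : 'M[F]_(2, n.+1)) :=
  row_free N /\ forall x, (x \in val L) = (x <= N)%MS.

Lemma spans_mul L (A : 'M[F]_2) N : A \in unitmx -> spans L N -> spans L (A *m N).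
Proof.
move=> Au [fN LN]; have AN : (A *m N :=: N)%MS.
  by apply: eqmxMfull; rewrite row_full_unit.
by split=> [|x]; [rewrite /row_free AN|rewrite LN AN].
Qed.

Lemma mulmx_row2 (D : 'rV[F]_2) (N : 'M_(2, n.+1)) :
  D *m N = D 0 0 *: row 0 N + D 0 1 *: row 1 N.
Proof.
rewrite mulmx_sum_row !big_ord_recl big_ord0 addr0.
by have -> : lift ord0 ord0 = 1 :> 'I_2 by apply: val_inj.
Qed.

Lemma row_free2P (u v : 'rV[F]_n.+1) (N : 'M_(2, n.+1)) :
  row 0 N = u -> row 1 N = v -> free [:: u; v] = row_free N.
Proof.
move=> Nu Nv.
have NE (D : 'rV_2) : D *m N = D 0 0 *: u + D 0 1 *: v.
  by rewrite mulmx_row2 Nu Nv.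
rewrite free_cons span_seq1 seq1_free; apply/andP/idP => [[uv v0]|fN].
  rewrite -kermx_eq0; apply: contraT => /rowV0Pn[D /sub_kermxP DN] /negP[].
  rewrite NE in DN.
  have D0 : D 0 0 = 0.
    apply: contraNeq uv => D0; apply/vlineP; exists (- (D 0 1 / D 0 0)).
    apply: (scalerI D0); rewrite scalerA mulrN mulrCA divff // mulr1 scaleNr.
    by apply/eqP; rewrite -addr_eq0 DN.
  have D1 : D 0 1 = 0.
    move: DN; rewrite D0 scale0r add0r => /eqP; rewrite scaler_eq0 (negbTE v0).
    by rewrite orbF => /eqP.
  apply/eqP/rowP => j; rewrite mxE; case: j => [[|[]]] // j2.
    by rewrite -[RHS]D0; congr (D 0 _); apply: val_inj.
  by rewrite -[RHS]D1; congr (D 0 _); apply: val_inj.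
have inj (D : 'rV_2) : D *m N = 0 -> D = 0.
  by move=> DN; apply: (row_free_inj fN); rewrite mul0mx.
split.
  apply/negP => /vlineP[k uk].
  have /inj/rowP/(_ 0) : (\row_(j < 2) (if j == 0 then 1 else - k)) *m N = 0.
    by rewrite NE !mxE /= uk scale1r scaleNr subrr.
  by rewrite !mxE /= => /eqP; rewrite oner_eq0.
apply/eqP => v0; have /inj/rowP/(_ 1) : (\row_(j < 2) (j == 1)%:R) *m N = 0.
  by rewrite NE !mxE /= v0 scale0r scaler0 addr0.
by rewrite !mxE /= => /eqP; rewrite oner_eq0.
Qed.

Lemma mem_span2 (u v : 'rV[F]_n.+1) (N : 'M_(2, n.+1)) x :
  row 0 N = u -> row 1 N = v -> (x \in <<[:: u; v]>>%VS) = (x <= N)%MS.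
Proof.
move=> Nu Nv.
have NE (D : 'rV_2) : D *m N = D 0 0 *: u + D 0 1 *: v.
  by rewrite mulmx_row2 Nu Nv.
rewrite span_cons span_seq1; apply/memv_addP/submxP.
  case=> _ /vlineP[k ->] [_ /vlineP[k' ->] ->].
  exists (\row_(j < 2) (if j == 0 then k else k')); by rewrite NE !mxE /=.
case=> D ->; rewrite NE; exists (D 0 0 *: u); first by apply/vlineP; exists (D 0 0).
by exists (D 0 1 *: v) => //; apply/vlineP; exists (D 0 1).
Qed.

Definition vbasis_rows (L : line F n) : 'M[F]_(2, n.+1) :=
  \matrix_(r, c) (vbasis (val L))`_r 0 c.

Lemma spans_vbasis L : spans L (vbasis_rows L).
Proof.
have [u [v bE]] : exists u v, vbasis (val L) = [:: u; v] :> seq _.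
  have : size (vbasis (val L)) = 2%N by rewrite size_tuple (eqP (valP L)).
  by case: (tval (vbasis _)) => [|u [|v [|]]] // _; exists u, v.
have Nu : row 0 (vbasis_rows L) = u by apply/rowP => c; rewrite !mxE bE.
have Nv : row 1 (vbasis_rows L) = v by apply/rowP => c; rewrite !mxE bE.
have /andP[/eqP bU fb] := vbasisP (val L); rewrite bE in bU fb.
by split=> [|x]; [rewrite -(row_free2P Nu Nv)|rewrite -(mem_span2 _ Nu Nv) bU].
Qed.

Lemma line_of_rows (N : 'M[F]_(2, n.+1)) : row_free N -> exists L, spans L N.
Proof.
move=> fN; have fr := fN; rewrite -(row_free2P erefl erefl) in fr.
exists (Sub <<[:: row 0%R N; row 1%R N]>>%VS fr); split=> // x.
by rewrite SubK (mem_span2 _ erefl erefl).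
Qed.

Lemma spans_trans L N N' : spans L N -> spans L N' ->
  exists2 A, A \in unitmx & N' = A *m N.
Proof.
move=> [fN LN] [fN' LN'].
have /submxP[A AN] : (N' <= N)%MS.
  by apply/row_subP => i; rewrite -LN LN' row_sub.
exists A => //; rewrite -row_free_unit /row_free eqn_leq rank_leq_row /=.
by have := mxrankM_maxl A N; rewrite -AN; move/eqP: fN' => ->.
Qed.


End Lines.

(** * Descent of nonvanishing conditions from bases to the Grassmannian *)

Section Genericity.

Variable F : numClosedFieldType.
Variables n l : nat.
Hypothesis n_gt0 : (0 < n)%N.

(** Antisymmetric extension to all pairs of indices; the last branch is i = j. *)
Definition plcoord (p : pluecker_index l n -> F) (a : 'I_l) (i j : 'I_n.+1) : F :=
  if (insub (i, j) : option {ij : 'I_n.+1 * 'I_n.+1 | (ij.1 < ij.2)%N}) is Some ij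
  then p (a, ij)
  else if (insub (j, i) : option {ij : 'I_n.+1 * 'I_n.+1 | (ij.1 < ij.2)%N})
    is Some ji then - p (a, ji) else 0.

Lemma polyfun_plcoord a i j : polyfun (fun p => plcoord p a i j).
Proof.
rewrite /plcoord; case: insub => [ij|]; first exact: polyfun_coord.
case: insub => [ji|]; last exact: polyfun_const.
by apply: polyfun_opp; exact: polyfun_coord.
Qed.

Lemma plcoord_scale p (lam : 'I_l -> F) a i j :
  plcoord (fun k => lam k.1 * p k) a i j = lam a * plcoord p a i j.
Proof.
rewrite /plcoord; case: insub => [ij|] //=.
by case: insub => [ji|] //=; rewrite ?mulrN ?mulr0.
Qed.

Lemma plcoord_pluecker (L : 'I_l -> line F n) a i j :
  plcoord (pluecker L) a i j =
  vbasis_rows (L a) 0 i * vbasis_rows (L a) 1 j -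
  vbasis_rows (L a) 0 j * vbasis_rows (L a) 1 i.
Proof.
rewrite /plcoord; case: insubP => [ij _ Eij|nij].
  by rewrite /pluecker /= Eij /= !mxE.
case: insubP => [ji _ Eji|nji].
  by rewrite /pluecker /= Eji /= !mxE opprB; congr (_ - _); rewrite mulrC.
have -> : i = j.
  by apply/val_inj/eqP; rewrite /= eqn_leq leqNgt nji leqNgt nij.
by rewrite subrr.
Qed.

Let i0 : 'I_n.+1 := ord0.
Let i1 : 'I_n.+1 := Ordinal (n_gt0 : 1 < n.+1)%N.

(* The contractions of a Pluecker vector with two basis covectors are two
   points of the line. *)
Definition plrows (p : pluecker_index l n -> F) a : 'M[F]_(2, n.+1) :=
  \matrix_(r, c) if r == 0 then plcoord p a c i1 else plcoord p a i0 c.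

Let block (N : 'M[F]_(2, n.+1)) : 'M[F]_2 :=
  \matrix_(r, s) N r (if s == 0 then i0 else i1).

(** The adjugate of [block N]. *)
Let coblock (N : 'M[F]_(2, n.+1)) : 'M[F]_2 :=
  \matrix_(r, s) if r == 0 then (if s == 0 then N 1 i1 else - N 0 i1)
                 else (if s == 0 then - N 1 i0 else N 0 i0).

Let mxE2 (m k : nat) (A : 'M[F]_(m, 2)) (B : 'M[F]_(2, k)) r c :
  (A *m B) r c = A r 0 * B 0 c + A r 1 * B 1 c.
Proof.
rewrite mxE !big_ord_recl big_ord0 addr0.
by have -> : lift ord0 ord0 = 1 :> 'I_2 by apply: val_inj.
Qed.

Let det_block N : \det (block N) = N 0 i0 * N 1 i1 - N 0 i1 * N 1 i0.
Proof.
rewrite (expand_det_row _ 0) !big_ord_recl big_ord0 /cofactor !det_mx11 !mxE /=.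
have -> : lift 0 0 = 1 :> 'I_2 by apply: val_inj.
by rewrite /bump /= !addn0 expr0 expr1; ring.
Qed.

Let block_coblock N : block N *m coblock N = (\det (block N))%:M.
Proof.
rewrite det_block; apply/matrixP => r c; rewrite mxE2 !mxE /=.
by case: (ord2_cases r) => ->; case: (ord2_cases c) => -> /=; rewrite ?mulr1n ?mulr0n; ring.
Qed.

Let plrows_pluecker (L : 'I_l -> line F n) a :
  plrows (pluecker L) a = coblock (vbasis_rows (L a)) *m vbasis_rows (L a).
Proof.
apply/matrixP => r c; rewrite mxE2 [LHS]mxE !plcoord_pluecker.
by rewrite ![coblock _ _ _]mxE; case: (ord2_cases r) => -> /=; ring.
Qed.

Let plcoord01 (L : 'I_l -> line F n) a :
  plcoord (pluecker L) a i0 i1 = \det (block (vbasis_rows (L a))).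
Proof. by rewrite plcoord_pluecker det_block. Qed.

(** Where the first Plücker coordinate is nonzero, [plrows] recovers a basis polynomially, which
    turns [h] into a polynomial in Plücker coordinates. That polynomial need not be
    multihomogeneous, so one of its multihomogeneous components defines the open set: where this
    component is nonzero, some rescaling of the Plücker vectors makes the whole polynomial nonzero,
    and rescaling only changes the bases of the same lines. *)
Lemma generically_of_polyfun (h : (rowpair_index n l -> F) -> F)
    (P : ('I_l -> line F n) -> Prop) :
  polyfun h -> (exists y, h y != 0) ->
  (forall y L, (forall a, spans (L a) (rowpair y a)) -> h y != 0 -> P L) ->
  generically P.
Proof.
move=> ph h0 hP.
have [y0] : exists y, h y * \prod_a \det (block (rowpair y a)) != 0.
  apply: polyfun_neq0_mul => //.
    apply: polyfun_prod => a; apply: polyfun_det => r s.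
    apply: polyfun_ext (polyfun_coord _ (a, r, if s == 0 then i0 else i1)) => y.
    by rewrite !mxE.
  exists (fun t => (t.2 == (if t.1.2 == 0 then i0 else i1))%:R).
  apply/prodf_neq0 => a _; rewrite det_block !mxE /= mulr1 !mul0r.
  by rewrite subr0 oner_eq0.
rewrite mulf_eq0 negb_or => /andP[hy0 /prodf_neq0 blk0].
(* [plrows] of a suitably scaled Plücker vector is the basis whose first two columns form the
   identity. Multiplying by [K] brings it back to [y0] on the lines spanned by [y0], so the open set
   is nonempty. *)
pose K a := block (rowpair y0 a).
have uK a : K a \in unitmx by rewrite unitmxE unitfE; exact: blk0.
pose yp p (t : rowpair_index n l) : F := (K t.1.1 *m plrows p t.1.1) t.1.2 t.2.
pose g p := h (yp p) * \prod_a plcoord p a i0 i1.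
have pg : polyfun g.
  apply: polyfun_mul.
    apply: (polyfun_comp (g := fun t p => yp p t)) => // -[[a r] c].
    apply: (@polyfun_ext _ _ (fun p => \sum_j K a r j *
      (if j == 0 then plcoord p a c i1 else plcoord p a i0 c))) => [p|].
      rewrite /yp [RHS]mxE; apply: eq_bigr => j _.
      by rewrite [plrows _ _ _ _]mxE.
    apply: polyfun_sum => j; apply: polyfun_mul; first exact: polyfun_const.
    by case: (j == 0); exact: polyfun_plcoord.
  by apply: polyfun_prod => a; exact: polyfun_plcoord.
have [G gE] := pg.
pose md (m : 'X_{1..#|pluecker_index l n|}) :=
  [multinom (\sum_(k | (enum_val k).1 == a) m k)%N | a < l].
(* A polynomial in one scaling factor per line, whose coefficients are the multihomogeneous
   components of [G] evaluated at [p]. *)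
pose W (p : pluecker_index l n -> F) : {mpoly F[l]} := \sum_(m <- msupp G)
  (G@_m * \prod_k p (enum_val k) ^+ m k) *: 'X_[md m].
have WE p lam : (W p).@[lam] = g (fun k => lam k.1 * p k).
  rewrite gE [RHS]mevalE /W raddf_sum; apply: eq_bigr => m _ /=.
  rewrite mevalZ mevalX -mulrA; congr (_ * _).
  rewrite [RHS](eq_bigr (fun k => lam (enum_val k).1 ^+ m k *
    p (enum_val k) ^+ m k)) => [|k _]; last by rewrite exprMn.
  rewrite big_split [LHS]mulrC; congr (_ * _).
  rewrite (partition_big (fun k => (enum_val k).1) predT) //=.
  apply: eq_bigr => a _; rewrite mnmE expr_sum.
  by apply: eq_bigr => k /eqP ->.
have /fin_all_exists[L0 L0E] : forall a, exists L, spans L (rowpair y0 a).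
  move=> a; apply: line_of_rows.
  have : \det (block (rowpair y0 a)) != 0 by exact: blk0.
  apply: contraR; rewrite -kermx_eq0 => /rowV0Pn[D /sub_kermxP DN D0].
  have Db : D *m block (rowpair y0 a) = 0.
    apply/rowP => s; rewrite mxE2 [in RHS]mxE ![block _ _ _]mxE -mxE2 DN.
    by rewrite mxE.
  apply/det0P; by exists D.
pose p0 := pluecker L0.
(* This scaling makes the first Plücker coordinate of each line equal to 1. *)
pose lam0 a := (\det (block (vbasis_rows (L0 a))))^-1.
have bvu a : \det (block (vbasis_rows (L0 a))) != 0.
  have [A uA NA] := spans_trans (spans_vbasis (L0 a)) (L0E a).
  have : \det (block (rowpair y0 a)) != 0 by exact: blk0.
  have -> : block (rowpair y0 a) = A *m block (vbasis_rows (L0 a)).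
    by apply/matrixP => r s; rewrite mxE2 NA [LHS]mxE mxE2 ![block _ _ _]mxE.
  by rewrite det_mulmx mulf_eq0 negb_or => /andP[].
have gp0 : g (fun k => lam0 k.1 * p0 k) != 0.
  rewrite mulf_neq0 //; last first.
    apply/prodf_neq0 => a _; rewrite plcoord_scale plcoord01 mulVf ?oner_eq0 //.
  rewrite (polyfun_eq (y := y0) ph) // => -[[a r] c]; rewrite /yp /=.
  have [A uA NA] := spans_trans (spans_vbasis (L0 a)) (L0E a).
  have -> : plrows (fun k => lam0 k.1 * p0 k) a = lam0 a *: plrows p0 a.
    by apply/matrixP => r' c'; rewrite !mxE !plcoord_scale; case: ifP.
  have KA : K a = A *m block (vbasis_rows (L0 a)).
    by apply/matrixP => r' s; rewrite mxE2 /K NA [LHS]mxE mxE2 ![block _ _ _]mxE.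
  rewrite -scalemxAr plrows_pluecker KA -!mulmxA (mulmxA (block _)) block_coblock.
  rewrite mul_scalar_mx -scalemxAr scalerA mulVf // scale1r -NA mxE.
  by [].
have [e We] : exists e, (W p0)@_e != 0.
  have Wn0 : W p0 != 0.
    by apply: contraNneq gp0 => W0; rewrite -WE W0 meval0.
  by exists (mlead (W p0)); rewrite mleadc_eq0.
pose f := \sum_(m <- msupp G | md m == e) G@_m *: 'X_[m].
have fE p : f.@[fun k => p (enum_val k)] = (W p)@_e.
  rewrite /f /W !raddf_sum big_mkcond /=; apply: eq_bigr => m _ /=.
  rewrite mcoeffZ mcoeffX; case: (md m == e); last by rewrite mulr0.
  by rewrite mevalZ mevalX mulr1.
exists (fun L => f.@[fun k => pluecker L (enum_val k)] != 0); split.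
- exists (fun f' => f' = f); split=> [_ ->|L]; last first.
    by split=> [fL|[_ -> //]]; exists f.
  exists e => m mf a; have : md m == e.
    apply: contraTT mf => nme; rewrite -mcoeff_eq0 raddf_sum big1 //= => m' me.
    rewrite mcoeffZ mcoeffX (_ : (m' == m) = false) ?mulr0 //.
    by apply: contraNF nme => /eqP <-.
  by move/eqP <-; rewrite mnmE.
- by exists L0; rewrite fE.
move=> L; rewrite fE => WL.
have [lam] : exists lam, (W (pluecker L)).@[lam] != 0.
  by apply: mpoly_neq0_meval; apply: contraNneq WL => ->; rewrite mcoeff0.
rewrite WE mulf_eq0 negb_or => /andP[hL /prodf_neq0 pL].
apply: hP hL => a.
have := pL a isT; rewrite plcoord_scale plcoord01 mulf_eq0 negb_or.
case/andP=> lama bL.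
have -> : rowpair (yp (fun k => lam k.1 * pluecker L k)) a =
    (lam a *: (K a *m coblock (vbasis_rows (L a)))) *m vbasis_rows (L a).
  apply/matrixP => r c; rewrite [LHS]mxE /yp /=.
  have -> : plrows (fun k => lam k.1 * pluecker L k) a =
      lam a *: plrows (pluecker L) a.
    by apply/matrixP => r' c'; rewrite !mxE !plcoord_scale; case: ifP.
  by rewrite plrows_pluecker -scalemxAr -scalemxAl mulmxA.
apply: spans_mul (spans_vbasis _).
rewrite unitmxZ ?unitfE // unitmx_mul uK /=.
have := congr1 determinant (block_coblock (vbasis_rows (L a))).
rewrite det_mulmx det_scalar unitmxE unitfE => E.
by apply: contraNneq (expf_neq0 2 bL) => c0; rewrite -E c0 mulr0.
Qed.

End Genericity.

(** * Restricting forms to a line *)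

Section TwoRows.

Variable F : numClosedFieldType.
Variable n : nat.
Implicit Types u v x : 'rV[F]_n.+1.

Definition rows2 u v : 'M[F]_(2, n.+1) :=
  \matrix_(r, c) (if r == 0 then u else v) 0 c.

Lemma rows2_0 u v c : rows2 u v 0 c = u 0 c. Proof. by rewrite mxE. Qed.

Lemma rows2_1 u v c : rows2 u v 1 c = v 0 c. Proof. by rewrite mxE. Qed.

Lemma mulmx_rows2 u v (D : 'rV_2) : D *m rows2 u v = D 0 0 *: u + D 0 1 *: v.
Proof.
by rewrite mulmx_row2; congr (_ *: _ + _ *: _); apply/rowP => c; rewrite !mxE.
Qed.

Lemma rows2_subP u v x :
  reflect (exists a b, x = a *: u + b *: v) (x <= rows2 u v)%MS.
Proof.
apply: (iffP submxP) => [[D ->]|[a [b ->]]].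
  by exists (D 0 0), (D 0 1); rewrite mulmx_rows2.
exists (\row_(j < 2) if j == 0 then a else b); by rewrite mulmx_rows2 !mxE.
Qed.

Lemma rows2_free u v a b :
  row_free (rows2 u v) -> a *: u + b *: v = 0 -> a = 0 /\ b = 0.
Proof.
move=> fN E; have : (\row_(j < 2) if j == 0 then a else b) = 0.
  by apply: (row_free_inj fN); rewrite mulmx_rows2 !mxE /= mul0mx.
by move/rowP => H; move: (H 0) (H 1); rewrite !mxE.
Qed.

Lemma spans_eqmx (L : line F n) (N N' : 'M[F]_(2, n.+1)) :
  spans L N -> (N <= N')%MS -> spans L N'.
Proof.
move=> [fN LN] NN'; have rN' : row_free N'.
  rewrite /row_free eqn_leq rank_leq_row /=.
  by have := mxrankS NN'; move/eqP: fN => ->.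
have EN : (N == N')%MS.
  by rewrite -(mxrank_leqif_eq NN').2 (eqP fN) (eqP rN').
by split=> // x; rewrite LN (eqmxP EN).
Qed.

End TwoRows.

Section Restriction.

Variable F : numClosedFieldType.
Variable n : nat.
Variables (L : line F n) (u v : 'rV[F]_n.+1).

Let N := rows2 u v.
Hypothesis LN : spans L N.

(** Restriction to the line in the affine parameter t of u + t v. The point [v] lies at infinity,
    and a form of degree d takes there the value of the coefficient of degree d. *)
Definition restr (f : {mpoly F[n.+1]}) : {poly F} :=
  mmap (@polyC F) (fun i => (u 0 i)%:P + 'X * (v 0 i)%:P) f.

Lemma restr_horner f t : (restr f).[t] = f.@[(u + t *: v) 0].
Proof.
rewrite mmap_horner; apply: meval_eq => i.
by rewrite hornerD hornerM hornerX !hornerC !mxE.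
Qed.

Lemma homog_meval d (f : {mpoly F[n.+1]}) c (x : 'rV_n.+1) :
  f \is d.-homog -> f.@[(c *: x) 0] = c ^+ d * f.@[x 0].
Proof.
move=> /dhomogP hf; rewrite !mevalE mulr_sumr; apply: eq_big_seq => m /hf <-.
rewrite mulrCA; congr (_ * _).
under eq_bigr do rewrite mxE exprMn.
by rewrite big_split /= mdegE expr_sum.
Qed.

Let top_coef (p : {poly F}) d c := (size p <= d.+1)%N /\ p`_d = c.

Let top_coefM p q d e a b :
  top_coef p d a -> top_coef q e b -> top_coef (p * q) (d + e) (a * b).
Proof.
move=> [sp pd] [sq qe]; split.
  apply: (leq_trans (size_polyMleq _ _)).
  by move: (size p) (size q) sp sq => s t; clear; lia.
rewrite coefM (bigD1 (inord d)) //= inordK ?ltnS ?leq_addr // addKn pd qe.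
rewrite big1 ?addr0 // => i ni.
have [di|id|Ei] := ltngtP d i.
- by rewrite nth_default ?mul0r // (leq_trans sp).
- rewrite [X in _ * X]nth_default ?mulr0 // (leq_trans sq) //.
  by move: (ltn_ord i) id; clear; lia.
by case/negP: ni; apply/eqP/val_inj; rewrite /= inordK ?ltnS ?leq_addr.
Qed.

Lemma restr_top d (f : {mpoly F[n.+1]}) : f \is d.-homog ->
  (size (restr f) <= d.+1)%N /\ (restr f)`_d = f.@[v 0].
Proof.
move=> /dhomogP hf; rewrite /restr /mmap mevalE.
have HT m : m \in msupp f -> top_coef
    ((f@_m)%:P * mmap1 (fun i => (u 0 i)%:P + 'X * (v 0 i)%:P) m) d
    (f@_m * \prod_i v 0 i ^+ m i).
  move=> mf; have <- : mdeg m = d by exact: hf.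
  rewrite -[X in top_coef _ X]add0n; apply: top_coefM.
    by split; [exact: size_polyC_leq1|rewrite coefC].
  rewrite mdegE /mmap1.
  elim/big_rec3: _ => [|i x s p _ IH]; first by split; rewrite ?size_poly1 ?coef1.
  apply: top_coefM IH; elim: (m i) => [|k IH].
    by split; rewrite ?expr0 ?size_poly1 ?coef1.
  rewrite exprS [_ ^+ k.+1]exprS -[k.+1]add1n; apply: top_coefM IH; split.
    apply: (leq_trans (size_polyD _ _)); rewrite geq_max.
    rewrite (leq_trans (size_polyC_leq1 _)) //= mulrC mul_polyC.
    by rewrite (leq_trans (size_scale_leq _ _)) // size_polyX.
  by rewrite coefD coefC mulrC mul_polyC coefZ coefX /= mulr1 add0r.
split.
  apply: (leq_trans (size_sum _ _ _)); rewrite big_seq_cond.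
  by apply/bigmax_leqP_seq => m; rewrite andbT => /HT[].
by rewrite coef_sum; apply: eq_big_seq => m /HT[].
Qed.

Lemma ideal_line_restr d (f : dhomog n.+1 F d) :
  ideal_part (line_points L) f <-> restr f = 0.
Proof.
have hf := dhomog_is_dhomog f; have [fN memL] := LN.
split=> [If|rf x [x0]].
  apply: poly_horner0 => t; rewrite restr_horner; apply: If; split.
    apply: contraTneq isT => E; suff : 1 = 0 :> F by move/eqP; rewrite oner_eq0.
    by have [] := rows2_free fN (etrans (congr1 (+%R^~ _) (scale1r u)) E).
  by rewrite memL; apply/rows2_subP; exists 1, t; rewrite scale1r.
rewrite memL => /rows2_subP[a [b ->]].
have [->|a0] := eqVneq a 0.
  rewrite scale0r add0r (homog_meval _ _ hf); have [_ <-] := restr_top hf.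
  by rewrite rf coef0 mulr0.
have -> : a *: u + b *: v = a *: (u + (b / a) *: v).
  by rewrite scalerDr scalerA mulrCA divff // mulr1.
by rewrite (homog_meval _ _ hf) -restr_horner rf horner0 mulr0.
Qed.

(** A right inverse of [N] supplies two linear forms restricting to 1 and 'X, in which [p] is
    homogenised. *)
Lemma restr_lift d (p : {poly F}) : (size p <= d.+1)%N ->
  exists f : dhomog n.+1 F d, restr f = p.
Proof.
have [fN _] := LN; have /row_freeP[B NB] := fN.
pose ell (j : 'I_2) : {mpoly F[n.+1]} := \sum_c B c j *: 'X_c.
have hell j : ell j \is 1.-homog.
  by apply: rpred_sum => c _; apply: rpredZ; rewrite dhomogX; apply/eqP/mdeg1.
have rell j : restr (ell j) = ((1%:M : 'M_2) 0 j)%:P +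
    'X * ((1%:M : 'M_2) 1 j)%:P.
  rewrite -NB /ell /restr raddf_sum !mxE !rmorph_sum mulr_sumr -big_split /=.
  apply: eq_bigr => c _; rewrite mmapZ mmapX mmap1U /=.
  rewrite rows2_0 rows2_1 !polyCM; ring.
have r0 : restr (ell 0) = 1.
  by rewrite rell !mxE !eqxx /= mulr0 addr0.
have r1 : restr (ell 1) = 'X.
  by rewrite rell !mxE !eqxx /= add0r mulr1.
move=> sp; pose f := \sum_(k < d.+1) p`_k *:
  (ell 0 ^+ (d - k) * ell 1 ^+ k).
have hf : f \is d.-homog.
  apply: rpred_sum => k _; apply: rpredZ.
  have : ell 0 ^+ (d - k) * ell 1 ^+ k \is (1 * (d - k) + 1 * k)%N.-homog.
    by apply: dhomogM; apply: dhomogMn.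
  by rewrite !mul1n subnK // -ltnS.
exists (DHomog hf) => /=; rewrite /f /restr raddf_sum.
rewrite -[RHS]coefK poly_def (big_ord_widen _ (fun k => p`_k *: 'X^k) sp).
rewrite [RHS]big_mkcond; apply: eq_bigr => k _ /=.
rewrite mmapZ rmorphM !rmorphXn /= -!/(restr _) r0 r1 expr1n mul1r mul_polyC.
by case: ltnP => // kp; rewrite nth_default // scale0r.
Qed.


End Restriction.

(** * Rational normal curves *)

Section RationalNormalCurve.

Variable F : numClosedFieldType.
Variable n : nat.
Hypothesis n_gt1 : (1 < n)%N.

(* [None] is the point at infinity of the projective line. *)
Definition pt (t : option F) : 'rV[F]_n.+1 :=
  \row_i (if t is Some a then a ^+ i else (i == n :> nat)%:R).

Lemma veronese_pt (g : 'M[F]_n.+1) x :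
  (exists s t c : F, [/\ (s, t) != (0, 0), c != 0 & x = c *: (veronese n s t *m g)])
  <-> exists t (c : F), c != 0 /\ x = c *: (pt t *m g).
Proof.
split.
  case=> s [t [c [st c0 ->]]]; have [s0|s0] := eqVneq s 0.
    have t0 : t != 0 by apply: contraNneq st => ->; rewrite s0.
    exists None, (c * t ^+ n); split; first by rewrite mulf_neq0 ?expf_neq0.
    rewrite -scalerA; congr (_ *: _); rewrite scalemxAl; congr (_ *m _); apply/rowP => i.
    rewrite !mxE s0; have [->|ni] := eqVneq (i : nat) n.
      by rewrite subnn mul1r mulr1.
    rewrite mulr0 expr0n subn_eq0 leqNgt ltn_neqAle ni -ltnS ltn_ord mul0r.
    by [].
  exists (Some (t / s)), (c * s ^+ n); split.
    by rewrite mulf_neq0 ?expf_neq0.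
  rewrite -scalerA; congr (_ *: _); rewrite scalemxAl; congr (_ *m _); apply/rowP => i.
  rewrite !mxE expr_div_n mulrCA mulrC; congr (_ * _).
  apply: (mulIf (expf_neq0 i s0)).
  by rewrite -mulrA mulVf ?expf_neq0 // mulr1 -exprD subnK // -ltnS.
case=> -[a|] [c [c0 ->]].
  exists 1, a, c; split=> //; first by rewrite xpair_eqE oner_eq0.
  congr (_ *: (_ *m g)); apply/rowP => i.
  by rewrite !mxE expr1n mul1r.
exists 0, 1, c; split=> //; first by rewrite xpair_eqE oner_eq0 andbF.
congr (_ *: (_ *m g)); apply/rowP => i; rewrite !mxE expr1n mulr1 expr0n subn_eq0.
by rewrite eqn_leq -ltnS ltn_ord.
Qed.

Lemma rnc_pt (C : pset F n) : is_rational_normal_curve C ->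
  exists2 g : 'M[F]_n.+1, g \in unitmx &
    forall x, C x <-> exists t (c : F), c != 0 /\ x = c *: (pt t *m g).
Proof. by case=> g gu CE; exists g => // x; rewrite CE veronese_pt. Qed.

Let s0 (i : 'I_n) : 'I_n.+1 := widen_ord (leqnSn n) i.
Let s1 (i : 'I_n) : 'I_n.+1 := lift ord0 i.

(** Vanishing of the 2 by 2 minors of the Hankel matrix with rows y_0, ..., y_(n-1) and y_1, ...,
    y_n. *)
Definition on_nu (y : 'rV[F]_n.+1) :=
  forall i j, y 0 (s0 i) * y 0 (s1 j) = y 0 (s1 i) * y 0 (s0 j).

Lemma on_nu_pt t c : on_nu (c *: pt t).
Proof.
move=> i j; rewrite !mxE /= /bump /=; case: t => [a|].
  by rewrite !add1n !exprS; ring.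
by rewrite !(ltn_eqF (ltn_ord _)) !mulr0 mul0r.
Qed.

Lemma nu_on_pt y : on_nu y -> y != 0 -> exists t (c : F), c != 0 /\ y = c *: pt t.
Proof.
move=> ony y0; pose f k := y 0 (inord k).
have fS k m : (k < n)%N -> (m < n)%N -> f k * f m.+1 = f k.+1 * f m.
  move=> kn mn; have := ony (Ordinal kn) (Ordinal mn).
  have E0 q (qn : (q < n)%N) : s0 (Ordinal qn) = inord q.
    by apply: val_inj; rewrite /= inordK // ltnW.
  have E1 q (qn : (q < n)%N) : s1 (Ordinal qn) = inord q.+1.
    by apply: val_inj; rewrite /= /bump inordK.
  by rewrite !E0 !E1.
have yf i : y 0 i = f i by rewrite /f inord_val.
have n0 : (0 < n)%N by exact: ltnW.
have [f0|f0] := eqVneq (f 0%N) 0.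
  have fk k : (k < n)%N -> f k = 0.
    (* The minor (k, k + 1) reads f_k f_(k+2) = f_(k+1)^2, so the vanishing propagates up to index n
       - 1. *)
    elim: k => // k IH kn; have := fS k k.+1 (ltnW kn) kn.
    by rewrite IH 1?ltnW // mul0r => /esym/eqP; rewrite mulf_eq0 orbb => /eqP.
  exists None, (f n); have yE : y = f n *: pt None.
    apply/rowP => i; rewrite yf !mxE; have [->|ni] := eqVneq (i : nat) n.
      by rewrite mulr1.
    by rewrite mulr0 fk // ltn_neqAle ni -ltnS ltn_ord.
  by split=> //; apply: contraNneq y0 => fn0; rewrite yE fn0 scale0r.
exists (Some (f 1%N / f 0%N)), (f 0%N); split=> //; apply/rowP => i.
rewrite yf !mxE; have := ltn_ord i; rewrite ltnS; elim: (i : nat) => [|k IH] kn.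
  by rewrite mulr1.
apply: (mulfI f0); rewrite (fS 0%N k) // IH 1?ltnW // exprS.
by field.
Qed.

Definition dpt (a : F) : 'rV[F]_n.+1 := \row_i (a ^+ i.-1 *+ i).
(** The next to last coordinate vector, which spans the tangent at infinity together with
    [pt None]. *)
Definition dpt_inf : 'rV[F]_n.+1 := \row_i (i.+1 == n :> nat)%:R.

Definition polar (y w : 'rV[F]_n.+1) i j :=
  y 0 (s0 i) * w 0 (s1 j) + w 0 (s0 i) * y 0 (s1 j) -
  (y 0 (s1 i) * w 0 (s0 j) + w 0 (s1 i) * y 0 (s0 j)).

(** The minors cut out the curve as a smooth scheme, so the vectors killed by all their polars at a
    point form the tangent line there. *)
Lemma polar0_tangent t c y : c != 0 ->
  (forall i j, polar y (c *: pt t) i j = 0) ->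
  exists al be, y = al *: pt t + be *: (if t is Some a then dpt a else dpt_inf).
Proof.
move=> c0 By; pose f k := y 0 (inord k).
have yf i : y 0 i = f i by rewrite /f inord_val.
have E0 q : y 0 (s0 q) = f q by rewrite yf.
have E1 q : y 0 (s1 q) = f q.+1 by rewrite yf /= /bump.
case: t By => [a|] By.
  (* The minors (k, 0) give a first order recursion, so [y] is determined by its first two
     coordinates. *)
  have fE k : (k < n)%N -> a * f k - f k.+1 = a ^+ k * (a * f 0%N - f 1%N).
    move=> kn; have := By (Ordinal kn) (Ordinal (ltnW n_gt1)).
    rewrite /polar !mxE !E0 !E1 /= /bump /= !add1n expr0 expr1 exprS => B.
    apply: (mulfI c0); apply/eqP; rewrite -subr_eq0 -[X in _ == X]B.
    by apply/eqP; ring.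
  exists (f 0%N), (f 1%N - a * f 0%N); apply/rowP => i; rewrite yf !mxE.
  have := ltn_ord i; rewrite ltnS; elim: (i : nat) => [|k IH] kn.
    by rewrite mulr0n mulr0 addr0 mulr1.
  have -> : f k.+1 = a * f k - (a * f k - f k.+1) by ring.
  rewrite fE // IH 1?ltnW //=.
  case: k {IH kn} => [|k]; first by rewrite !mulr0n !expr1 !expr0 mulr1n; ring.
  rewrite /= [a ^+ k.+1 *+ _]mulrS !exprS -mulrnAr.
  by move: (a ^+ k *+ _) => T; ring.
have nn : (n.-1 < n)%N by rewrite prednK // ltnW.
have nE : n.-1.+1 = n by rewrite prednK // ltnW.
have fE k : (k < n.-1)%N -> f k = 0.
  move=> kn; have kn' : (k < n)%N by rewrite (leq_trans kn) ?leq_pred.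
  have := By (Ordinal kn') (Ordinal nn).
  rewrite /polar !mxE !E0 !E1 /= /bump /= !add1n nE eqxx.
  rewrite (ltn_eqF kn') (ltn_eqF nn) (_ : (k.+1 == n) = false); last first.
    by apply/negbTE; rewrite -nE eqSS neq_ltn kn.
  rewrite !mulr0 !mul0r mulr1 !addr0 subr0 => /eqP.
  by rewrite mulf_eq0 (negbTE c0) orbF => /eqP.
exists (f n), (f n.-1); apply/rowP => i; rewrite yf !mxE.
have := ltn_ord i; rewrite ltnS leq_eqVlt => /predU1P[->|lt].
  by rewrite eqxx (gtn_eqF (ltnSn n)) mulr1 mulr0 addr0.
rewrite (ltn_eqF lt) mulr0 add0r.
have [->|ni] := eqVneq (i : nat) n.-1; first by rewrite nE eqxx mulr1.
rewrite -[X in _ == X]nE eqSS (negbTE ni) mulr0 fE //.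
by rewrite ltn_neqAle ni -ltnS nE.
Qed.

Section Quadrics.

Variables (C : pset F n) (g : 'M[F]_n.+1).
Hypothesis gu : g \in unitmx.
Hypothesis CE : forall x, C x <-> exists t (c : F), c != 0 /\ x = c *: (pt t *m g).

Let coord k : {mpoly F[n.+1]} := \sum_c invmx g c k *: 'X_c.

Lemma coord_homog k : coord k \is 1.-homog.
Proof.
by apply: rpred_sum => c _; apply: rpredZ; rewrite dhomogX; apply/eqP/mdeg1.
Qed.

Lemma coord_meval k (x : 'rV_n.+1) : (coord k).@[x 0] = (x *m invmx g) 0 k.
Proof.
rewrite raddf_sum mxE; apply: eq_bigr => c _ /=.
by rewrite mevalZ mevalXU mulrC.
Qed.

Let minor_homog i j :
  coord (s0 i) * coord (s1 j) - coord (s1 i) * coord (s0 j) \is 2.-homog.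
Proof.
by apply: rpredB; apply: (@dhomogM _ _ _ 1 _ 1); exact: coord_homog.
Qed.

Definition minor i j : dhomog n.+1 F 2 := DHomog (minor_homog i j).

Lemma minor_meval i j (x : 'rV_n.+1) (y := x *m invmx g) :
  (minor i j : {mpoly F[n.+1]}).@[x 0] =
  y 0 (s0 i) * y 0 (s1 j) - y 0 (s1 i) * y 0 (s0 j).
Proof. by rewrite mevalB !mevalM !coord_meval. Qed.

Lemma ideal_minor i j : ideal_part C (minor i j).
Proof.
move=> x /CE[t [c [_ ->]]]; rewrite minor_meval -scalemxAl mulmxK //.
by rewrite on_nu_pt subrr.
Qed.

Lemma minors_curve (x : 'rV_n.+1) : x != 0 ->
  (forall i j, (minor i j : {mpoly F[n.+1]}).@[x 0] = 0) ->
  exists t (c : F), c != 0 /\ x = c *: (pt t *m g).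
Proof.
move=> x0 mx; have [||t [c [c0 E]]] := @nu_on_pt (x *m invmx g).
- by move=> i j; have /eqP := mx i j; rewrite minor_meval subr_eq0 => /eqP.
- by apply: contraNneq x0 => E; rewrite -(mulmxKV gu x) E mul0mx.
by exists t, c; split=> //; rewrite scalemxAl -E mulmxKV.
Qed.

Lemma restr_minor (u v : 'rV_n.+1) i j (y := u *m invmx g) (w := v *m invmx g) :
  (restr u v (minor i j))`_1 = polar y w i j.
Proof.
have rc k : restr u v (coord k) = (y 0 k)%:P + 'X * (w 0 k)%:P.
  rewrite /y /w !mxE /restr raddf_sum !rmorph_sum mulr_sumr -big_split /=.
  apply: eq_bigr => c _; rewrite mmapZ mmapX mmap1U /= !polyCM; ring.
rewrite /= /restr rmorphB !rmorphM /= -!/(restr _ _ _) !rc.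
set p := _ - _; have -> : p = (y 0 (s0 i) * y 0 (s1 j) - y 0 (s1 i) * y 0 (s0 j))%:P
   + (polar y w i j)%:P * 'X
   + (w 0 (s0 i) * w 0 (s1 j) - w 0 (s1 i) * w 0 (s0 j))%:P * 'X^2.
  by rewrite /p /polar !(polyCD, polyCN, polyCM); ring.
by rewrite !coefD coefC coefCM coefX coefCM coefXn /= mulr0 addr0 add0r mulr1.
Qed.

End Quadrics.

End RationalNormalCurve.

(** * Degree of the intersection with a line *)

Section SchemeDegree.

Variable F : numClosedFieldType.
Variable n : nat.
Implicit Types (L : line F n) (u v : 'rV[F]_n.+1).

Section RestrictionMap.

Variables (u v : 'rV[F]_n.+1) (d : nat).

Let restr_linear c (f h : dhomog n.+1 F d) :
  restr u v (c *: f + h : dhomog n.+1 F d) = c%:P * restr u v f + restr u v h.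
Proof.
have -> : mpoly_of_dhomog (c *: f + h) = c *: mpoly_of_dhomog f + h by [].
by rewrite /restr raddfD /= mmapZ.
Qed.

Let coefs (f : dhomog n.+1 F d) : 'rV[F]_d.+1 := \row_k (restr u v f)`_k.

Let coefs_linear : linear coefs.
Proof.
move=> c f h; apply/rowP => k.
by rewrite !mxE restr_linear coefD coefCM.
Qed.

HB.instance Definition _ :=
  GRing.isLinear.Build F (dhomog n.+1 F d) 'rV[F]_d.+1 _ coefs coefs_linear.

Definition restr_hom : 'Hom(dhomog n.+1 F d, 'rV[F]_d.+1) := linfun coefs.

Lemma restr_homE f k : restr_hom f 0 k = (restr u v f)`_k.
Proof. by rewrite lfunE mxE. Qed.

Lemma restr_hom_eq0 (f : dhomog n.+1 F d) :
  (f \in lker restr_hom) = (restr u v f == 0).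
Proof.
rewrite memv_ker; apply/eqP/eqP => [E|E]; last first.
  by apply/rowP => k; rewrite restr_homE E coef0 mxE.
apply/polyP => k; rewrite coef0; have [kd|dk] := ltnP k d.+1.
  by have := restr_homE f (Ordinal kd); rewrite E mxE.
have [sz _] := restr_top u v (dhomog_is_dhomog f).
by rewrite nth_default // (leq_trans sz).
Qed.

Let ends (f : dhomog n.+1 F d) : 'rV[F]_2 :=
  \row_k (if k == 0 then (restr u v f)`_0 else (restr u v f)`_d).

Let ends_linear : linear ends.
Proof.
move=> c f h; apply/rowP => k.
by rewrite !mxE restr_linear !coefD !coefCM; case: (k == 0).
Qed.

HB.instance Definition _ :=
  GRing.isLinear.Build F (dhomog n.+1 F d) 'rV[F]_2 _ ends ends_linear.

Definition ends_hom : 'Hom(dhomog n.+1 F d, 'rV[F]_2) := linfun ends.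

Lemma ends_hom_eq0 (f : dhomog n.+1 F d) :
  (f \in lker ends_hom) = ((restr u v f)`_0 == 0) && ((restr u v f)`_d == 0).
Proof.
rewrite memv_ker lfunE /=; apply/eqP/andP => [/rowP E|[/eqP E0 /eqP Ed]].
  by have := E 0; have := E 1; rewrite !mxE /= => -> ->; rewrite eqxx.
by apply/rowP => k; rewrite !mxE E0 Ed; case: (k == 0).
Qed.

Lemma dim_ends_ker L : (0 < d)%N -> spans L (rows2 u v) ->
  (\dim (lker ends_hom) + 2)%N = \dim {: dhomog n.+1 F d}%VS.
Proof.
move=> d0 LN; rewrite -(limg_ker_dim ends_hom fullv) capfv.
suff -> : limg ends_hom = fullv by rewrite dimvf.
apply/eqP; rewrite eqEsubv subvf; apply/subvP => r _.
have [|f fE] := @restr_lift F n L u v LN d ((r 0 0)%:P + (r 0 1)%:P * 'X^d).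
  apply: (leq_trans (size_polyD _ _)); rewrite geq_max.
  rewrite (leq_trans (size_polyC_leq1 _)) // mul_polyC.
  by rewrite (leq_trans (size_scale_leq _ _)) // size_polyXn.
have -> : r = ends_hom f; last exact: memv_img (memvf _).
rewrite lfunE; apply/rowP => k; rewrite !mxE fE !coefD !coefC !coefCM !coefXn.
rewrite eqxx (gtn_eqF d0) [0%N == d]eq_sym (gtn_eqF d0) /=.
rewrite mulr0 addr0 add0r mulr1; case: k => [[|[|]]] // k2; congr (r 0 _);
exact: val_inj.
Qed.

End RestrictionMap.

(* Two binary quadratic forms with distinct leading positions generate a space
   of codimension at most one in every large degree. *)
Lemma degree2_equal_sizes (C : pset F n) L u v (f1 f2 : dhomog n.+1 F 2) :
  spans L (rows2 u v) -> scheme_inter_degree C (line_points L) 2 ->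
  ideal_part C f1 -> ideal_part C f2 -> (0 < size (restr u v f2))%N ->
  (size (restr u v f1) <= size (restr u v f2))%N.
Proof.
move=> LN [d0 deg] C1 C2 sz2; rewrite leqNgt; apply/negP => lt21.
pose e := d0; pose d := (2 + e)%N; have [|U UE dimU] := deg d; first exact: leq_addl.
pose phi := restr_hom u v d.
pose q1 := restr u v f1; pose q2 := restr u v f2.
have inU (f : dhomog n.+1 F 2) (h : dhomog n.+1 F e) (fh : dhomog n.+1 F d) :
    ideal_part C f -> fh = (f : {mpoly F[n.+1]}) * (h : {mpoly F[n.+1]}) :> {mpoly F[n.+1]} -> fh \in U.
  move=> If E; apply/UE; exists fh, 0; split; last by rewrite addr0.
    by move=> x /If fx; rewrite E mevalM fx mul0r.
  by move=> x _; exact: meval0.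
(* Since [U] contains the forms vanishing on the line, its codimension can be computed after
   restriction. *)
have kerU : (lker phi <= U)%VS.
  apply/subvP => f; rewrite restr_hom_eq0 => /eqP f0; apply/UE; exists 0, f.
  split; last by rewrite add0r.
    by move=> x _; exact: meval0.
  by apply/(ideal_line_restr LN).
(* The last polynomial is longer than all the others, so these e + 2 are independent among the e + 3
   dimensions of restrictions of degree e + 2: the codimension would be at most 1 instead of 2. *)
pose G (i : 'I_e.+2) : {poly F} := if (i <= e)%N then q2 * 'X^i else q1 * 'X^e.
have /fin_all_exists2[fG fGU fGE] (i : 'I_e.+2) :
    exists2 f : dhomog n.+1 F d, f \in U & restr u v f = G i.
  have lift k (f : dhomog n.+1 F 2) : (k <= e)%N -> ideal_part C f ->
      exists2 f' : dhomog n.+1 F d, f' \in U & restr u v f' = restr u v f * 'X^k.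
    move=> ke If; have [|h hE] := @restr_lift F n L u v LN e 'X^k.
      by rewrite size_polyXn ltnS.
    have hom : (f : {mpoly F[n.+1]}) * h \is d.-homog.
      by apply: dhomogM; exact: dhomog_is_dhomog.
    exists (DHomog hom); first exact: (inU f h).
    by rewrite /restr /= rmorphM /= -!/(restr _ _ _) hE.
  rewrite /G; case: leqP => ie; first exact: lift.
  exact: lift.
pose X := [tuple phi (fG i) | i < e.+2].
have fX : free X.
  apply/freeP => c c0 i.
  have P0 : \sum_(i < e.+2) c i *: G i = 0.
    apply/polyP => k; rewrite coef0; have [kd|dk] := ltnP k d.+1; last first.
      rewrite nth_default //; apply: leq_trans dk.
      apply: (leq_trans (size_sum _ _ _)); apply/bigmax_leqP => j _.
      apply: (leq_trans (size_scale_leq _ _)); rewrite -fGE.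
      by have [] := restr_top u v (dhomog_is_dhomog (fG j)).
    have := congr1 (fun w : 'rV_ _ => w 0 (Ordinal kd)) c0.
    rewrite [in RHS]mxE summxE coef_sum => E; rewrite -[RHS]E.
    apply: eq_bigr => j _; rewrite mxE -tnth_nth tnth_mktuple restr_homE fGE.
    by rewrite coefZ.
  have c_last : c ord_max = 0.
    apply: contraTeq isT => cn0; move: P0; rewrite big_ord_recr /=.
    rewrite {2}/G /= ltnn; set S := \sum_(i < _) _ => P0.
    have SE : S = - (c ord_max *: (q1 * 'X^e)).
      by apply/eqP; rewrite -addr_eq0 P0.
    have : (size S <= size q2 + e)%N.
      apply: (leq_trans (size_sum _ _ _)); apply/bigmax_leqP => j _.
      have je : (j <= e)%N by rewrite -ltnS.
      rewrite /G /= je; apply: (leq_trans (size_scale_leq _ _)).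
      apply: (leq_trans (size_polyMleq _ _)); rewrite size_polyXn addnS /=.
      by rewrite leq_add2l.
    have q10 : q1 != 0 by rewrite -size_poly_gt0 (leq_trans _ lt21).
    rewrite SE size_polyN size_scale // size_mulXn // addnC leq_add2r.
    by rewrite leqNgt lt21.
  have := P0; rewrite big_ord_recr /= c_last scale0r addr0.
  rewrite (eq_bigr (fun j : 'I_e.+1 => q2 * (c (widen_ord (leqnSn _) j) *: 'X^j))).
    rewrite -mulr_sumr => /eqP; rewrite mulf_eq0.
    rewrite -size_poly_eq0 (gtn_eqF sz2) /= => /eqP S0.
    case: (unliftP ord_max i) => [j ->|-> //].
    have := congr1 (fun p : {poly F} => p`_j) S0.
    rewrite coef0 coef_sum (bigD1 j) //= coefZ coefXn eqxx mulr1 big1 ?addr0.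
      by move=> <-; congr c; apply: val_inj; rewrite /= /bump leqNgt ltn_ord.
    move=> k kj; rewrite coefZ coefXn (_ : (j == k :> nat) = false) ?mulr0 //.
    by rewrite eq_sym; apply/negbTE.
  move=> j _; have je : (j <= e)%N by rewrite -ltnS.
  by rewrite /G /= je scalerAr.
have dimX : (e.+2 <= \dim (phi @: U))%N.
  have <- : \dim <<X>> = e.+2 by rewrite (eqP fX) size_tuple.
  apply: dimvS; apply/span_subvP => w /tnthP[i ->].
  by rewrite tnth_mktuple memv_img.
have := limg_ker_dim phi U; have := limg_ker_dim phi fullv.
rewrite capfv (capv_idPr kerU).
have := dimvS (subvf (limg phi)); rewrite dimvf /dim /= mul1n.
move: dimU dimX; rewrite /d.
move: (\dim U) (\dim {:_}) (\dim (phi @: U)) (\dim (limg phi)) (\dim (lker phi)).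
by clear; lia.
Qed.

End SchemeDegree.

(** * Intersection of degree two: chords and tangents *)

Section Chords.

Variable F : numClosedFieldType.
Variable n : nat.
Hypothesis n_gt1 : (1 < n)%N.

(* The row space, up to a projectivity, of a chord or tangent of the curve:
   two finite points, one point at infinity, tangent at a finite point,
   tangent at infinity. *)
Definition chord_rows (T : nat) (a b : F) : 'M[F]_(2, n.+1) :=
  rows2 (if T == 3%N then pt n None else pt n (Some a))
    (match T with
     | 0 => pt n (Some b) | 1 => pt n None | 2 => dpt n a | _ => dpt_inf F n
     end).

Variables (C : pset F n) (g : 'M[F]_n.+1).
Hypothesis gu : g \in unitmx.
Hypothesis CE : forall x, C x <-> exists t (c : F), c != 0 /\ x = c *: (pt n t *m g).

(** The minor (0, 1) restricts to a nonzero multiple of 'X, which vanishes simply at [u] and at [v],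
    the point at infinity. Its multiples together with the ideal of the line give all forms of
    degree at least 2 vanishing at both ends, a space of codimension 2. *)
Lemma secant_degree2 (L : line F n) a b : a != b ->
  spans L (rows2 (pt n (Some a) *m g) (pt n (Some b) *m g)) ->
  scheme_inter_degree C (line_points L) 2.
Proof.
set u := _ *m g; set v := pt n (Some b) *m g => ab LN.
have Cu : C u by apply/CE; exists (Some a), 1; rewrite oner_eq0 scale1r.
have Cv : C v by apply/CE; exists (Some b), 1; rewrite oner_eq0 scale1r.
have u0 : u != 0.
  apply: contraTneq isT => E; have [+ _] : 1 = 0 :> F /\ 0 = 0 :> F.
    by apply: (rows2_free LN.1); rewrite scale1r scale0r E addr0.
  by move/eqP; rewrite oner_eq0.
have v0 : v != 0.
  apply: contraTneq isT => E; have [_] : 0 = 0 :> F /\ 1 = 0 :> F.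
    by apply: (rows2_free LN.1); rewrite scale1r scale0r E addr0.
  by move/eqP; rewrite oner_eq0.
have Lu : line_points L u.
  by split=> //; rewrite LN.2; apply/rows2_subP; exists 1, 0; rewrite scale1r scale0r addr0.
have Lv : line_points L v.
  by split=> //; rewrite LN.2; apply/rows2_subP; exists 0, 1; rewrite scale1r scale0r add0r.
have n0 : (0 < n)%N by exact: ltnW.
pose m := minor g (Ordinal n0) (Ordinal n_gt1).
have If : ideal_part C m by apply: ideal_minor.
have rm : restr u v m = ((a - b) ^+ 2)%:P * 'X.
  have [sz top] := restr_top u v (dhomog_is_dhomog m).
  have r0 : (restr u v m)`_0 = 0.
    by rewrite -horner_coef0 restr_horner scale0r addr0; exact: If.
  have r2 : (restr u v m)`_2 = 0 by rewrite top; exact: If.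
  apply/polyP => k; rewrite coefCM coefX.
  case: k => [|[|[|k]]]; rewrite ?r0 ?r2 ?mulr0 //; last first.
    by rewrite nth_default // (leq_trans sz).
  rewrite restr_minor /u /v !mulmxK // /polar !mxE /= /bump /= mulr1.
  by rewrite !add1n !expr0 !expr1; ring.
exists 2%N => d d2; have [e dE] : exists e, d = (2 + e)%N.
  by exists (d - 2)%N; rewrite subnKC.
subst d; exists (lker (ends_hom u v (2 + e))); last first.
  by apply: (dim_ends_ker _ LN).
move=> f; have [sz top] := restr_top u v (dhomog_is_dhomog f).
have E0 : (restr u v f)`_0 = (f : {mpoly F[n.+1]}).@[u 0].
  by rewrite -horner_coef0 restr_horner scale0r addr0.
rewrite ends_hom_eq0 E0 top; split; last first.
  case=> p [q [Ip Iq ->]].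
  have pq x : C x -> line_points L x ->
      ((p + q : dhomog n.+1 F (2 + e)) : {mpoly F[n.+1]}).@[x 0] = 0.
    move=> Cx Lx; have -> : mpoly_of_dhomog (p + q) =
      mpoly_of_dhomog p + mpoly_of_dhomog q by [].
    by rewrite mevalD Ip // Iq // addr0.
  by rewrite !pq // eqxx.
case/andP=> /eqP fu /eqP fv.
have [h hE] : exists h, restr u v f = 'X * h.
  have /factor_theorem[h hE] : root (restr u v f) 0.
    by rewrite rootE horner_coef0 E0 fu.
  by exists h; rewrite hE subr0 mulrC.
have szh : (size h <= e.+1)%N.
  apply/leq_sizeP => k; rewrite leq_eqVlt => /predU1P[<-|ek].
    by have := top; rewrite hE coefXM /= fv.
  by have /leq_sizeP/(_ k.+1) := sz; rewrite hE coefXM /=; apply.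
have [k kE] := restr_lift LN (leq_trans (size_scale_leq ((a - b) ^- 2) h) szh).
have hom : (m : {mpoly F[n.+1]}) * (k : {mpoly F[n.+1]}) \is (2 + e).-homog.
  by apply: dhomogM; exact: dhomog_is_dhomog.
exists (DHomog hom), (f - DHomog hom); split; last by rewrite addrC subrK.
  by move=> x Cx /=; rewrite mevalM If // mul0r.
apply/(ideal_line_restr LN).
have -> : mpoly_of_dhomog (f - DHomog hom) = mpoly_of_dhomog f -
  (m : {mpoly F[n.+1]}) * (k : {mpoly F[n.+1]}) by [].
rewrite /restr raddfB /= rmorphM /= -!/(restr _ _ _) rm kE hE -mul_polyC.
rewrite [X in _ - X]mulrCA !mulrA -polyCM mulVf ?expf_neq0 ?subr_eq0 //.
by rewrite mul1r subrr.
Qed.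

Section DegreeTwo.

Variable L : line F n.
Hypothesis deg2 : scheme_inter_degree C (line_points L) 2.

(** Cancelling the leading term of one restricted minor against another would give two nonzero
    restrictions of different sizes. Thus the quadrics through the curve induce on the line a single
    binary quadratic form up to scalars. *)
Let restr_minors_colinear u v i0 j0 i j : spans L (rows2 u v) ->
  restr u v (minor g i0 j0) != 0 ->
  exists c, restr u v (minor g i j) = c *: restr u v (minor g i0 j0).
Proof.
move=> LN q0n; set q0 := restr u v (minor g i0 j0) in q0n *.
set q := restr u v (minor g i j).
have I1 k l : ideal_part C (minor g k l) by apply: ideal_minor.
have sq : (size q <= size q0)%N.
  by apply: (degree2_equal_sizes LN deg2) => //; rewrite size_poly_gt0.
exists (q`_(size q0).-1 / lead_coef q0).
set c := _ / _; apply/eqP; rewrite -subr_eq0.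
pose f : dhomog n.+1 F 2 := minor g i j - c *: minor g i0 j0.
have fE : mpoly_of_dhomog f = mpoly_of_dhomog (minor g i j) -
  c *: mpoly_of_dhomog (minor g i0 j0) by [].
have If : ideal_part C f.
  by move=> x Cx; rewrite fE mevalB mevalZ !I1 // mulr0 subr0.
have rf : restr u v f = q - c *: q0.
  by rewrite fE /restr raddfB /= mmapZ mul_polyC.
rewrite -rf; apply: contraT => rf0.
have : (size q0 <= size (restr u v f))%N.
  by apply: (degree2_equal_sizes LN deg2) => //; rewrite size_poly_gt0.
have lq0 : lead_coef q0 != 0 by rewrite lead_coef_eq0.
suff : (size (restr u v f) <= (size q0).-1)%N.
  move=> le1 le2; have := leq_trans le2 le1.
  by rewrite -ltnS prednK ?ltnn // size_poly_gt0.
apply/leq_sizeP => k; rewrite leq_eqVlt => /predU1P[<-|lt].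
  by rewrite rf coefB coefZ /c -/(lead_coef q0) divfK ?subrr.
have szk : (size q0 <= k)%N := leq_trans (leqSpred _) lt.
by rewrite rf coefB coefZ !nth_default ?(leq_trans sq) // mulr0 subr0.
Qed.

Let meets_curve u v : spans L (rows2 u v) ->
  exists2 p, p != 0 & p \in val L /\
    forall i j, (minor g i j : {mpoly F[n.+1]}).@[p 0] = 0.
Proof.
move=> LN; have nz a b : (a, b) != (0, 0) -> a *: u + b *: v != 0.
  by apply: contraNneq => /(rows2_free LN.1) [-> ->].
have mem a b : a *: u + b *: v \in val L.
  by rewrite LN.2; apply/rows2_subP; exists a, b.
have uE : 1 *: u + 0 *: v = u by rewrite scale1r scale0r addr0.
have vE : 0 *: u + 1 *: v = v by rewrite scale1r scale0r add0r.
have u0 : u != 0 by rewrite -[X in X != _]uE nz // xpair_eqE oner_eq0.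
have v0 : v != 0 by rewrite -[X in X != _]vE nz // xpair_eqE oner_eq0 andbF.
have [/existsP[i0 /existsP[j0 q0]]|/existsPn all0] :=
  boolP [exists i, exists j, restr u v (minor g i j) != 0].
  have col i j := restr_minors_colinear i j LN q0.
  (* A nonzero constant is a quadratic form whose double zero is at infinity, that is at [v]. *)
  have [s1|s1] := eqVneq (size (restr u v (minor g i0 j0))) 1%N.
    exists v => //; split; first by rewrite -[X in X \in _]vE mem.
    move=> i j; have [c cE] := col i j.
    have [_ <-] := restr_top u v (dhomog_is_dhomog (minor g i j)).
    by rewrite cE coefZ nth_default ?mulr0 // s1.
  have /closed_rootP[z /rootP qz] := s1.
  exists (u + z *: v).
    by rewrite -[u in u + _]scale1r nz // xpair_eqE oner_eq0.
  split; first by rewrite -[u in u + _]scale1r mem.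
  move=> i j; have [c cE] := col i j.
  by rewrite -restr_horner cE hornerZ qz mulr0.
exists u => //; split; first by rewrite -[X in X \in _]uE mem.
move=> i j; have := restr_horner u v (minor g i j) 0.
rewrite scale0r addr0 => <-.
have /existsPn/(_ j) := all0 i; rewrite negbK => /eqP ->.
by rewrite horner0.
Qed.

Let basis_with p : p != 0 -> p \in val L -> exists v, spans L (rows2 v p).
Proof.
move=> p0 pL; have LN := spans_vbasis L; move: (vbasis_rows L) LN => N LN.
have NE : N = rows2 (row 0 N) (row 1 N).
  apply/matrixP => r c; rewrite !mxE; case: eqP => [->|/eqP r0]; rewrite mxE //.
  by congr (N _ c); case: r r0 => [[|[|]]] // r2 _; apply: val_inj.
have : (p <= N)%MS by rewrite -LN.2.
rewrite NE => /rows2_subP[a [b pE]].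
have [b0|b0] := eqVneq b 0.
  have a0 : a != 0.
    by apply: contraNneq p0 => a0; rewrite pE a0 b0 !scale0r addr0.
  exists (row 1 N); apply: (spans_eqmx LN); rewrite {1}NE.
  apply/row_subP => r; rewrite rowK; apply/rows2_subP; case: (r == 0).
    exists 0, a^-1; rewrite pE b0 !scale0r addr0 add0r scalerA mulVf // scale1r.
    by apply/rowP => c; rewrite !mxE.
  exists 1, 0; rewrite scale1r scale0r addr0.
  by apply/rowP => c; rewrite !mxE.
exists (row 0 N); apply: (spans_eqmx LN); rewrite {1}NE.
apply/row_subP => r; rewrite rowK; apply/rows2_subP; case: (r == 0).
  by exists 1, 0; rewrite scale1r scale0r addr0; apply/rowP => c; rewrite !mxE.
exists (- (a / b)), b^-1; rewrite pE scalerDr !scalerA mulVf // scale1r.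
rewrite addrA -scalerDl mulrC addNr scale0r add0r.
by apply/rowP => c; rewrite !mxE.
Qed.

(** A point [p] of the line on the curve is put at infinity. A finite zero of the common quadratic
    form is a second point of the curve and gives a chord; if there is none, the zero at [p] is
    double and the line is the tangent at [p]. *)
Lemma degree2_chord (N : 'M[F]_(2, n.+1)) : spans L N ->
  exists T a b, [/\ (T < 4)%N, a != b &
    exists K : 'M[F]_2, N = K *m (chord_rows T a b *m g)].
Proof.
move=> LN; suff : exists T a b, [/\ (T < 4)%N, a != b & (N <= chord_rows T a b *m g)%MS].
  by case=> T [a [b [T4 ab /submxP[K ->]]]]; exists T, a, b; split=> //; exists K.
have LN0 := LN; have NE : N = rows2 (row 0 N) (row 1 N).
  apply/matrixP => r c; rewrite !mxE; case: eqP => [->|/eqP r0]; rewrite mxE //.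
  by congr (N _ c); case: r r0 => [[|[|]]] // r2 _; apply: val_inj.
rewrite NE in LN0; have [p p0 [pL mp]] := meets_curve LN0.
have [v Lv] := basis_with p0 pL.
have [t [c [c0 pE]]] := minors_curve n_gt1 gu p0 mp.
have toL w (M : 'M_(2, n.+1)) : spans L (rows2 w p) ->
    (w <= M)%MS -> (p <= M)%MS -> (N <= M)%MS.
  move=> Lw wM pM; apply/row_subP => r.
  have : row r N \in val L by rewrite LN.2 row_sub.
  rewrite Lw.2 => /rows2_subP[x [y ->]].
  by rewrite addmx_sub // scalemx_sub.
(* Where [b] does not enter the rows it is set to a + 1, so that every type still provides two
   distinct parameters to normalise. *)
have ab1 (a : F) : a != a + 1 by rewrite -subr_eq0 opprD addNKr oppr_eq0 oner_eq0.
have row1 (T : nat) a b x (k : F) : x = k *: (pt n (Some a) *m g) ->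
    (T < 3)%N -> (x <= chord_rows T a b *m g)%MS.
  move=> -> T3; rewrite scalemx_sub // submxMr //.
  apply/rows2_subP; exists 1, 0.
  by rewrite scale1r scale0r addr0 (ltn_eqF T3).
have row2 (T : nat) a b x (k : F) :
    x = k *: (pt n (if T == 0%N then Some b else None) *m g) ->
    (T < 2)%N -> (x <= chord_rows T a b *m g)%MS.
  move=> -> T2; rewrite scalemx_sub // submxMr //.
  apply/rows2_subP; exists 0, 1; rewrite scale1r scale0r add0r.
  by case: T T2 => [|[|]].
have second w : spans L (rows2 w p) -> w != 0 ->
    (forall i j, (minor g i j : {mpoly F[n.+1]}).@[w 0] = 0) ->
    exists T a b, [/\ (T < 4)%N, a != b & (N <= chord_rows T a b *m g)%MS].
  move=> Lw w0 mw; have [s [e [e0 wE]]] := minors_curve n_gt1 gu w0 mw.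
  have st : s != t.
    apply: contraTneq isT => st; have [+ _] : e^-1 = 0 /\ - c^-1 = 0.
      apply: (rows2_free Lw.1); rewrite wE pE st !scalerA mulVf // mulNr mulVf //.
      by rewrite scaleN1r scale1r subrr.
    by move/eqP; rewrite invr_eq0 (negbTE e0).
  case: s t st wE pE => [a|] [b|] st wE pE.
  - exists 0%N, a, b; split=> //.
    by apply: (toL _ _ Lw); [apply: row1 wE _|apply: (@row2 0%N _ _ _ _ pE)].
  - exists 1%N, a, (a + 1); split=> //.
    by apply: (toL _ _ Lw); [apply: row1 wE _|apply: (@row2 1%N a (a + 1) _ _ pE)].
  - exists 1%N, b, (b + 1); split=> //.
    by apply: (toL _ _ Lw); [apply: (@row2 1%N b (b + 1) _ _ wE)|apply: row1 pE _].
  by case/eqP: st.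
have [/existsP[i0 /existsP[j0 q0]]|/existsPn all0] :=
  boolP [exists i, exists j, restr v p (minor g i j) != 0]; last first.
  apply: (second v Lv).
    apply: contraTneq isT => v0; have [+ _] : 1 = 0 :> F /\ 0 = 0 :> F.
      by apply: (rows2_free Lv.1); rewrite v0 scaler0 scale0r addr0.
    by move/eqP; rewrite oner_eq0.
  move=> i j; have := restr_horner v p (minor g i j) 0.
  rewrite scale0r addr0 => <-.
  have /existsPn/(_ j) := all0 i; rewrite negbK => /eqP ->.
  by rewrite horner0.
have col i j := restr_minors_colinear i j Lv q0.
have [s1|s1] := eqVneq (size (restr v p (minor g i0 j0))) 1%N; last first.
  have /closed_rootP[z /rootP qz] := s1.
  have Lw : spans L (rows2 (v + z *: p) p).
    apply: (spans_eqmx Lv); apply/row_subP => r; rewrite rowK.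
    apply/rows2_subP; case: (r == 0).
      exists 1, (- z); rewrite scale1r scaleNr addrK.
      by apply/rowP => k; rewrite ?mxE.
    exists 0, 1; rewrite scale1r scale0r add0r.
    by apply/rowP => k; rewrite ?mxE.
  apply: (second _ Lw).
    apply: contraTneq isT => v0; have [+ _] : 1 = 0 :> F /\ 0 = 0 :> F.
      by apply: (rows2_free Lw.1); rewrite v0 scaler0 scale0r addr0.
    by move/eqP; rewrite oner_eq0.
  move=> i j; have [k kE] := col i j.
  by rewrite -restr_horner kE hornerZ qz mulr0.
(* Here all restricted minors are constant, so their coefficients of degree 1, the polars at [p],
   vanish. *)
have pg : p *m invmx g = c *: pt n t by rewrite pE -scalemxAl mulmxK.
have [i j|al [be vE]] := @polar0_tangent F n n_gt1 t c (v *m invmx g) c0.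
  rewrite -pg -restr_minor; have [k ->] := col i j.
  by rewrite coefZ nth_default ?mulr0 // s1.
have {}vE : v = (al *: pt n t +
    be *: (if t is Some a then dpt n a else dpt_inf F n)) *m g.
  by rewrite -vE mulmxKV.
case: t pE vE {pg} => [a|] pE vE.
  exists 2%N, a, (a + 1); split=> //.
  apply: (toL _ _ Lv); last by apply: row1 pE _.
  by rewrite vE submxMr //; apply/rows2_subP; exists al, be.
exists 3%N, 0, 1; split=> //; first by rewrite eq_sym oner_eq0.
apply: (toL _ _ Lv).
  by rewrite vE submxMr //; apply/rows2_subP; exists al, be.
rewrite pE scalemx_sub // submxMr //; apply/rows2_subP; exists 1, 0.
by rewrite scale1r scale0r addr0.
Qed.

End DegreeTwo.

End Chords.

(** * The dimension count *)

Section AffineReparametrisation.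

Variable F : numClosedFieldType.
Variable n : nat.
Hypothesis n_gt0 : (0 < n)%N.
Variables al be : F.
Hypothesis al0 : al != 0.

Let q : {poly F} := al *: 'X + be%:P.

Let size_q : size q = 2%N.
Proof. by rewrite size_polyDl size_scale // size_polyX // ltnS size_polyC_leq1. Qed.

Let lead_q : lead_coef q = al.
Proof.
by rewrite lead_coefE size_q coefD coefZ coefX coefC /= mulr1 addr0.
Qed.

Let size_qX i : size (q ^+ i) = i.+1.
Proof.
have := size_exp q i; rewrite size_q mul1n => E.
rewrite -[in RHS]E prednK // size_poly_gt0 expf_neq0 //.
by rewrite -size_poly_gt0 size_q.
Qed.

Let coef_qX i : (q ^+ i)`_i = al ^+ i.
Proof. by have := lead_coef_exp q i; rewrite lead_q lead_coefE size_qX. Qed.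

Let A : 'M[F]_n.+1 := \matrix_(j, i) (q ^+ i)`_j.

Let qE x : q.[x] = al * x + be.
Proof. by rewrite hornerD hornerZ hornerX hornerC. Qed.

Let pt_affine x : pt n (Some x) *m A = pt n (Some (al * x + be)).
Proof.
apply/rowP => i; rewrite !mxE -qE -horner_exp.
rewrite (@horner_coef_wide _ n.+1) ?size_qX //.
by apply: eq_bigr => j _; rewrite !mxE mulrC.
Qed.

Let dpt_affine x : dpt n x *m A = al *: dpt n (al * x + be).
Proof.
apply/rowP => i; rewrite !mxE -qE.
have -> : al * (q.[x] ^+ i.-1 *+ i) = (q ^+ i)^`().[x].
  rewrite deriv_exp hornerMn hornerM horner_exp derivD derivZ derivX derivC.
  by rewrite addr0 hornerZ hornerC mulr1 mulrnAr.
rewrite (@horner_coef_wide _ n); last first.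
  rewrite -ltnS (leq_trans (lt_size_deriv _)) ?size_qX //.
  by rewrite -size_poly_gt0 size_qX.
rewrite big_ord_recl !mxE mulr0n mul0r add0r; apply: eq_bigr => j _.
by rewrite !mxE coef_deriv /= /bump /= add1n !mulrnAl mulrC.
Qed.

Let pt_inf_affine : pt n None *m A = al ^+ n *: pt n None.
Proof.
apply/rowP => i; rewrite !mxE (bigD1 ord_max) //= big1 ?addr0 => [|j nj].
  rewrite !mxE eqxx mul1r; have [->|ni] := eqVneq (i : nat) n.
    by rewrite coef_qX mulr1.
  rewrite mulr0 nth_default // size_qX ltn_neqAle ni -ltnS; exact: ltn_ord.
by rewrite !mxE (_ : (j == n :> nat) = false) ?mul0r //; apply/negbTE.
Qed.

Let dpt_inf_affine : exists k,
  dpt_inf F n *m A = al ^+ n.-1 *: dpt_inf F n + k *: pt n None.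
Proof.
have nE : n.-1.+1 = n by rewrite prednK.
exists (q ^+ n)`_n.-1; apply/rowP => i; rewrite !mxE.
have n1 : (n.-1 < n.+1)%N by rewrite ltnS leq_pred.
rewrite (bigD1 (Ordinal n1)) //= big1 ?addr0 => [|j nj].
  rewrite !mxE /= nE eqxx mul1r.
  have [->|ni] := eqVneq (i : nat) n.
    by rewrite (gtn_eqF (ltnSn n)) mulr0 add0r mulr1.
  rewrite mulr0 addr0; have [Ei|ni1] := eqVneq (i.+1 : nat) n.
    have E2 : n.-1 = i := congr1 predn (esym Ei).
    by rewrite E2 coef_qX mulr1.
  rewrite mulr0 nth_default // size_qX ltn_neqAle.
  have : (i <= n.-1)%N by rewrite -ltnS nE ltn_neqAle ni -ltnS ltn_ord.
  move=> ->; rewrite andbT; apply: contra ni1 => /eqP ->; exact/eqP.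
rewrite !mxE (_ : (j.+1 == n) = false) ?mul0r //; apply/negbTE.
by apply: contra nj => /eqP/(congr1 predn) E; apply/eqP/val_inj.
Qed.

(** One matrix must serve all lines at once: the action on the curve of t -> al t + be. This map
    fixes infinity, hence preserves the four types. *)
Lemma chord_rows_affine : exists A : 'M[F]_n.+1, forall T x y, (T < 4)%N ->
  (chord_rows n T (al * x + be) (al * y + be) <= chord_rows n T x y *m A)%MS.
Proof.
exists A => T x y T4.
have comb u v w a b : w = a *: (u *m A) + b *: (v *m A) ->
    (w <= rows2 u v *m A)%MS.
  move=> ->; rewrite !scalemxAl -mulmxDl submxMr //.
  by apply/rows2_subP; exists a, b.
have sub u v u' v' : (u' <= rows2 u v *m A)%MS -> (v' <= rows2 u v *m A)%MS ->
    (rows2 u' v' <= rows2 u v *m A)%MS.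
  by move=> su sv; apply/row_subP => r; rewrite rowK; case: (r == 0).
have s1 u v w a : w = a *: (u *m A) -> (w <= rows2 u v *m A)%MS.
  by move=> E; apply: (comb _ _ _ a 0); rewrite scale0r addr0.
have s2 u v w b : w = b *: (v *m A) -> (w <= rows2 u v *m A)%MS.
  by move=> E; apply: (comb _ _ _ 0 b); rewrite scale0r add0r.
have alnn : al ^- n * al ^+ n = 1 by rewrite mulVf // expf_neq0.
have inf : pt n None = al ^- n *: (pt n None *m A).
  by rewrite pt_inf_affine scalerA alnn scale1r.
case: T T4 => [|[|[|[|]]]] // _; apply: sub => /=.
- by apply: (s1 _ _ _ 1); rewrite pt_affine scale1r.
- by apply: (s2 _ _ _ 1); rewrite pt_affine scale1r.
- by apply: (s1 _ _ _ 1); rewrite pt_affine scale1r.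
- exact: s2 inf.
- by apply: (s1 _ _ _ 1); rewrite pt_affine scale1r.
- by apply: (s2 _ _ _ al^-1); rewrite dpt_affine scalerA mulVf // scale1r.
- exact: s1 inf.
have [k kE] := dpt_inf_affine.
apply: (comb _ _ _ (- (al ^- n.-1 * k * al ^- n)) (al ^- n.-1)).
rewrite kE pt_inf_affine scalerDr !scalerA mulVf ?expf_neq0 // scale1r mulNr.
by rewrite -(mulrA _ (al ^- n)) alnn mulr1 scaleNr addrCA addNr addr0.
Qed.

End AffineReparametrisation.

(** * Parameters against coordinates of l lines *)

Section Counting.

Variable F : numClosedFieldType.
Variables n l : nat.
Hypothesis n_gt1 : (1 < n)%N.
Hypothesis l_gt0 : (0 < l)%N.

Lemma polyfun_neq0_prod (K I : finType) (f : I -> (K -> F) -> F) :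
  (forall i, polyfun (f i)) -> (forall i, exists x, f i x != 0) ->
  exists x, \prod_i f i x != 0.
Proof.
move=> pf nf; elim: (index_enum I) => [|i s IH].
  by exists (fun=> 0); rewrite big_nil oner_eq0.
have [x fx] := polyfun_neq0_mul (pf i) (polyfun_prod s xpredT pf) (nf i) IH.
by exists x; rewrite big_cons.
Qed.

Let param : finType :=
  ('I_l * 'I_2 * 'I_2 + 'I_l * 'I_2 + 'I_n.+1 * 'I_n.+1)%type.

Let pK (a : 'I_l) (r j : 'I_2) : param := inl (inl (a, r, j)).
Let px (a : 'I_l) (j : 'I_2) : param := inl (inr (a, j)).
Let pG (i c : 'I_n.+1) : param := inr (i, c).

(** A choice of type for each line gives finitely many polynomial families, each of which is counted
    separately. *)
Let chordT (T : {ffun 'I_l -> 'I_4}) (t : rowpair_index n l) (z : param -> F) :=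
  \sum_j z (pK t.1.1 t.1.2 j) *
    \sum_i chord_rows n (T t.1.1) (z (px t.1.1 0)) (z (px t.1.1 1)) j i *
      z (pG i t.2).

Let chordT_polyfun T t : polyfun (chordT T t).
Proof.
apply: polyfun_sum => j; apply: polyfun_mul; first exact: polyfun_coord.
apply: polyfun_sum => i; apply: polyfun_mul; last exact: polyfun_coord.
have ppt k : polyfun (fun z : param -> F => pt n (Some (z k)) 0 i).
  apply: (polyfun_ext _ (polyfun_exp i (polyfun_coord F k))) => z.
  by rewrite mxE.
have pdpt k : polyfun (fun z : param -> F => dpt n (z k) 0 i).
  apply: (@polyfun_ext _ _ (fun z => z k ^+ i.-1 * i%:R)) => [z|].
    by rewrite mxE mulr_natr.
  apply: polyfun_mul (polyfun_const _ _).
  by apply: polyfun_exp; exact: polyfun_coord.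
have cst (w : 'rV[F]_n.+1) : polyfun (fun z : param -> F => w 0 i).
  exact: polyfun_const.
case: (ord2_cases j) => ->.
  apply: (@polyfun_ext _ _ (fun z : param -> F =>
      (if T t.1.1 == 3 :> nat then pt n None else pt n (Some (z (px t.1.1 0)))) 0 i)).
    by move=> z; rewrite rows2_0.
  by case: (_ == _); [exact: cst|exact: ppt].
apply: (@polyfun_ext _ _ (fun z : param -> F => (match T t.1.1 : nat with
    | 0 => pt n (Some (z (px t.1.1 1))) | 1 => pt n None
    | 2 => dpt n (z (px t.1.1 0)) | _ => dpt_inf F n end) 0 i)).
  by move=> z; rewrite rows2_1.
by case: (nat_of_ord _) => [|[|[|?]]]; [exact: ppt|exact: cst|exact: pdpt|exact: cst].
Qed.

(* The affine group and the scalars allow three of the parameters to be fixed. *)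
Lemma feasible_param (L : 'I_l -> line F n) y :
  feasible L -> (forall a, spans (L a) (rowpair y a)) ->
  exists T (z : param -> F) i c,
    [/\ z (px (Ordinal l_gt0) 0) = 0, z (px (Ordinal l_gt0) 1) = 1,
      z (pG i c) = 1 & y =1 chordT T ^~ z].
Proof.
case=> C /rnc_pt[g gu CE] deg LN.
have /fin_all_exists[f fE] : forall a, exists f : 'I_4 * F * F * 'M[F]_2,
    f.1.1.2 != f.1.2 /\
    rowpair y a = f.2 *m (chord_rows n f.1.1.1 f.1.1.2 f.1.2 *m g).
  move=> a; have [T [u [v [T4 uv [K KE]]]]] :=
    degree2_chord n_gt1 gu CE (deg a) (LN a).
  by exists (Ordinal T4, u, v, K).
pose a0 := Ordinal l_gt0.
(* The affine map t -> al t + be sends 0 and 1 to the two parameters of the line [a0]. *)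
pose be := (f a0).1.1.2; pose al := (f a0).1.2 - be.
have al0 : al != 0 by rewrite subr_eq0 eq_sym; case: (fE a0).
have [A AE] := chord_rows_affine (ltnW n_gt1) be al0.
pose x a := ((f a).1.1.2 - be) / al; pose x' a := ((f a).1.2 - be) / al.
have xE w : w = al * ((w - be) / al) + be.
  by rewrite mulrCA divff // mulr1 subrK.
pose G := A *m g.
have /fin_all_exists[K KE] : forall a, exists K : 'M[F]_2,
    rowpair y a = K *m (chord_rows n (f a).1.1.1 (x a) (x' a) *m G).
  move=> a; have [_ ->] := fE a.
  have := AE (f a).1.1.1 (x a) (x' a) (ltn_ord _).
  rewrite -!xE => /submxP[D ->].
  by exists ((f a).2 *m D); rewrite /G !mulmxA.
have [i [c Gic]] : exists i c, G i c != 0.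
  apply/matrix0Pn; apply: contraTneq isT => G0.
  have [+ _] := LN a0; rewrite KE G0 !mulmx0 /row_free mxrank0.
  by [].
exists [ffun a => (f a).1.1.1].
(* Dividing [G] by its entry (i, c) is compensated in the base changes [K]. *)
exists (fun k : param => match k with
  | inl (inl (a, r, j)) => K a r j * G i c
  | inl (inr (a, j)) => if j == 0 then x a else x' a
  | inr (i', c') => G i' c' / G i c
  end); exists i, c; split=> /=.
- by rewrite /x -/be subrr mul0r.
- by rewrite /x' -/al divff.
- by rewrite divff.
case=> [[a r] d]; have := congr1 (fun M : 'M_(2, n.+1) => M r d) (KE a).
rewrite [LHS]mxE => ->; rewrite mxE; apply: eq_bigr => j _ /=.
rewrite ffunE -mulrA; congr (_ * _); rewrite [LHS]mxE mulr_sumr.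
apply: eq_bigr => k _.
by rewrite mulrCA; congr (_ * _); rewrite mulrC divfK.
Qed.

(* Dimension count: 4 l + 2 (l - 1) + (n + 1)^2 - 1 < 2 (n + 1) l. *)
Lemma generically_infeasible :
  (6 * l + n.+1 ^ 2 < 2 * n.+1 * l + 3)%N ->
  generically (fun L : 'I_l -> line F n => ~ feasible L).
Proof.
move=> ineq; pose a0 := Ordinal l_gt0.
pose fixed i c : seq param := [:: px a0 0; px a0 1; pG i c].
pose free_param i c : finType := {k : param | k \notin fixed i c}.
have card i c : (#|free_param i c| < #|rowpair_index n l|)%N.
  rewrite card_sig.
  have -> : #|[pred k | k \notin fixed i c]| = (#|param| - 3)%N.
    have uf : uniq (fixed i c) by [].
    have c3 : #|fixed i c| = 3 by exact: (card_uniqP uf).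
    by have := cardC (mem (fixed i c)); rewrite c3 => <-; rewrite addKn.
  rewrite !card_prod !card_sum !card_prod !card_ord.
  by move: ineq l_gt0; clear; rewrite expnS expn1; nia.
(* Of the three fixed parameters, [px a0 0] gets the value 0 and the other two get 1. *)
pose full i c (w : free_param i c -> F) (k : param) : F :=
  if insub k is Some k' then w k' else (k != px a0 0)%:R.
have pfull i c k : polyfun (fun w : free_param i c -> F => full i c w k).
  by rewrite /full; case: insub => [k'|]; [exact: polyfun_coord|exact: polyfun_const].
have dep (s : {ffun 'I_l -> 'I_4} * 'I_n.+1 * 'I_n.+1) : exists h : (_ -> F) -> F,
    [/\ polyfun h, exists y, h y != 0 &
        forall w, h (fun t => chordT s.1.1 t (full s.1.2 s.2 w)) = 0].
  apply: (polyfun_dependent (card _ _)) => t.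
  exact: (polyfun_comp (chordT_polyfun _ _) (pfull _ _)).
have {dep}/fin_all_exists[h hE] := dep.
have ph s : polyfun (h s) by case: (hE s).
(* The product over all types and all normalised entries avoids every family simultaneously. *)
apply: (generically_of_polyfun (ltnW n_gt1) (polyfun_prod _ xpredT ph)).
  by apply: polyfun_neq0_prod => // s; case: (hE s).
move=> y L LN hy feas.
have [T [z [i [c [z0 z1 zG yE]]]]] := feasible_param feas LN.
have /prodf_neq0/(_ (T, i, c) isT)/eqP[] := hy.
have [_ _ h0] := hE (T, i, c).
rewrite -[RHS](h0 (fun k => z (val k))); apply: (polyfun_eq (ph _)) => t.
rewrite yE /=; apply: (polyfun_eq (chordT_polyfun T t)) => k.
rewrite /full; case: insubP => [k' _ -> //|]; rewrite negbK !inE.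
case/or3P => /eqP ->; rewrite ?z0 ?z1 ?zG.
- by rewrite eqxx.
- by [].
by [].
Qed.

End Counting.

(** * Five lines in P^4 *)

Section FiveLinesInP4.

Variable F : numClosedFieldType.

Let minors : seq (nat * nat) :=
  [:: (0, 1); (0, 2); (0, 3); (1, 2); (1, 3); (2, 3)]%N.

Let monomials : seq (nat * nat) :=
  [:: (0, 0); (0, 1); (0, 2); (0, 3); (0, 4); (1, 1); (1, 2); (1, 3); (1, 4);
      (2, 2); (2, 3); (2, 4); (3, 3); (3, 4); (4, 4)]%N.

(** The general quadric through the standard rational normal quartic, with one coefficient for each
    of the six Hankel minors. *)
Let minor_form (gam : nat -> F) (z : nat -> F) : F :=
  \sum_(m < 6) gam m * (z (nth (0, 0)%N minors m).1 * z (nth (0, 0)%N minors m).2.+1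
    - z (nth (0, 0)%N minors m).1.+1 * z (nth (0, 0)%N minors m).2).

Let quadratic (c : nat -> F) (x : nat -> F) : F :=
  \sum_(k < 15) c k *
    (x (nth (0, 0)%N monomials k).1 * x (nth (0, 0)%N monomials k).2).

Let unroll m (f : nat -> F) : \sum_(k < m) f k = foldr (fun k s => f k + s) 0 (iota 0 m).
Proof. by rewrite -(big_mkord xpredT f) /index_iota subn0 unlock. Qed.

Let minor_formE gam z : minor_form gam z =
  gam 0%N * (z 0%N * z 2%N - z 1%N * z 1%N) +
  gam 1%N * (z 0%N * z 3%N - z 1%N * z 2%N) +
  gam 2%N * (z 0%N * z 4%N - z 1%N * z 3%N) +
  gam 3%N * (z 1%N * z 3%N - z 2%N * z 2%N) +
  gam 4%N * (z 1%N * z 4%N - z 2%N * z 3%N) +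
  gam 5%N * (z 2%N * z 4%N - z 3%N * z 3%N).
Proof.
rewrite /minor_form (unroll 6 (fun m => gam m *
  (z (nth (0, 0)%N minors m).1 * z (nth (0, 0)%N minors m).2.+1
   - z (nth (0, 0)%N minors m).1.+1 * z (nth (0, 0)%N minors m).2))) /=.
by rewrite addr0 !addrA.
Qed.

Let quadraticE c x : quadratic c x =
  c 0%N * (x 0%N * x 0%N) + c 1%N * (x 0%N * x 1%N) + c 2%N * (x 0%N * x 2%N) +
  c 3%N * (x 0%N * x 3%N) + c 4%N * (x 0%N * x 4%N) + c 5%N * (x 1%N * x 1%N) +
  c 6%N * (x 1%N * x 2%N) + c 7%N * (x 1%N * x 3%N) + c 8%N * (x 1%N * x 4%N) +
  c 9%N * (x 2%N * x 2%N) + c 10%N * (x 2%N * x 3%N) + c 11%N * (x 2%N * x 4%N) +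
  c 12%N * (x 3%N * x 3%N) + c 13%N * (x 3%N * x 4%N) + c 14%N * (x 4%N * x 4%N).
Proof.
rewrite /quadratic (unroll 15 (fun k => c k *
  (x (nth (0, 0)%N monomials k).1 * x (nth (0, 0)%N monomials k).2))) /=.
by rewrite addr0 !addrA.
Qed.

Let nrow (x : 'rV[F]_5) (k : nat) : F := x 0 (inord k).

(** A quadric through the curve restricts to a multiple of xy on a chord and of y^2 on a tangent, so
    its value at the sum of the two rows decides whether it contains the line. *)
Let minor_form_chord gam T a b (r : 'I_2 -> nat -> F := fun r => nrow (row r (chord_rows 4 T a b))) :
  (T < 4)%N -> minor_form gam (fun k => r 0 k + r 1 k) = 0 ->
  forall x y, minor_form gam (fun k => x * r 0 k + y * r 1 k) = 0.
Proof.
have rE s k : (k < 5)%N -> r s k = chord_rows 4 T a b s (inord k).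
  by rewrite /r /nrow mxE.
move=> T4; rewrite !minor_formE !rE // => E0 x y; rewrite minor_formE !rE //.
move: T T4 {r rE} E0 => [|[|[|[|]]]] // _; rewrite /chord_rows !mxE /=;
rewrite ?mxE ?inordK //= => E0.
- by have := congr1 (fun w => x * y * w) E0; rewrite mulr0 => E;
    rewrite -[RHS]E; ring.
- by have := congr1 (fun w => x * y * w) E0; rewrite mulr0 => E;
    rewrite -[RHS]E; ring.
- by have := congr1 (fun w => y ^+ 2 * w) E0; rewrite mulr0 => E;
    rewrite -[RHS]E; ring.
by have := congr1 (fun w => y ^+ 2 * w) E0; rewrite mulr0 => E;
  rewrite -[RHS]E; ring.
Qed.

Let minor_form_eq0 gam : (forall z : 'rV_5, minor_form gam (nrow z) = 0) ->
  forall m, (m < 6)%N -> gam m = 0.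
Proof.
move=> H; have V (s : seq nat) : minor_form gam (fun k => (k \in s)%:R) = 0.
  rewrite -[RHS](H (\row_i (val i \in s)%:R)) !minor_formE.
  by rewrite /nrow !mxE /= !inordK.
(* The unit vectors isolate the coefficients of the three minors containing a square; the remaining
   vectors then isolate the other three. *)
have := (V [:: 1%N], V [:: 2%N], V [:: 3%N], V [:: 0; 3]%N, V [:: 0; 4]%N, V [:: 1; 4]%N).
rewrite !minor_formE /= ?inE /= ?(mulr0, mul0r, mulr1, subr0, sub0r, addr0, add0r, mulrN, mulrN1).
move=> [[[[[g0 g3] g5] g1] g2] g4].
have {}g0 : gam 0%N = 0 by apply/eqP; rewrite -oppr_eq0 g0.
have {}g3 : gam 3%N = 0 by apply/eqP; rewrite -oppr_eq0 g3.
have {}g5 : gam 5%N = 0 by apply/eqP; rewrite -oppr_eq0 g5.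
rewrite g0 g5 ?(oppr0, addr0, add0r) in g1 g2 g4.
by case=> [|[|[|[|[|[|]]]]]].
Qed.

(** Six coefficients against five linear conditions. *)
Let minor_form_kernel (z : 'I_5 -> nat -> F) : exists gam,
  (exists2 m, (m < 6)%N & gam m != 0) /\ forall a, minor_form gam (z a) = 0.
Proof.
pose A : 'M[F]_(6, 5) := \matrix_(m, a)
  minor_form (fun k => (k == m :> nat)%:R) (z a).
have /rowV0Pn[v /sub_kermxP vA v0] : kermx A != 0.
  rewrite kermx_eq0 -row_leq_rank -ltnNge.
  exact: leq_ltn_trans (rank_leq_col _) _.
exists (fun k => v 0 (inord k)); split.
  by have /rV0Pn[m vm] := v0; exists m; rewrite ?inord_val.
move=> a; have := congr1 (fun w : 'rV_5 => w 0 a) vA.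
rewrite [in RHS]mxE mxE => E; rewrite -[RHS]E.
apply: eq_bigr => m _; rewrite inord_val mxE /minor_form.
rewrite (bigD1 m) //= eqxx mul1r big1 ?addr0 // => k nk.
by rewrite (_ : (k == m :> nat) = false) ?mul0r //; apply/negbTE.
Qed.

Let minor_form_quadratic gam (A : 'M[F]_5) :
  exists c, forall x : 'rV_5, minor_form gam (nrow (x *m A)) = quadratic c (nrow x).
Proof.
have add (f g : 'rV_5 -> F) :
    (exists c, forall x, f x = quadratic c (nrow x)) ->
    (exists c, forall x, g x = quadratic c (nrow x)) ->
    exists c, forall x, f x + g x = quadratic c (nrow x).
  move=> [c cE] [d dE]; exists (fun k => c k + d k) => x.
  by rewrite cE dE /quadratic -big_split; apply: eq_bigr => k _; rewrite mulrDl.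
have scale t (f : 'rV_5 -> F) :
    (exists c, forall x, f x = quadratic c (nrow x)) ->
    exists c, forall x, t * f x = quadratic c (nrow x).
  move=> [c cE]; exists (fun k => t * c k) => x.
  by rewrite cE /quadratic mulr_sumr; apply: eq_bigr => k _; rewrite mulrA.
have prod s t : exists c, forall x : 'rV_5,
    nrow (x *m A) s * nrow (x *m A) t = quadratic c (nrow x).
  pose u i := A (inord i) (inord s); pose w i := A (inord i) (inord t).
  exists (fun k => let: (i, j) := nth (0, 0)%N monomials k in
    if i == j then u i * w i else u i * w j + u j * w i) => x.
  have lin p : nrow (x *m A) p = \sum_(k < 5) nrow x k * A (inord k) (inord p).
    by rewrite /nrow mxE; apply: eq_bigr => k _; rewrite !inord_val.
  rewrite !lin (unroll 5 (fun k => nrow x k * A (inord k) (inord s))).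
  rewrite (unroll 5 (fun k => nrow x k * A (inord k) (inord t))) quadraticE /=.
  rewrite -/(u _) /u /w; ring.
have diff (f g : 'rV_5 -> F) :
    (exists c, forall x, f x = quadratic c (nrow x)) ->
    (exists c, forall x, g x = quadratic c (nrow x)) ->
    exists c, forall x, f x - g x = quadratic c (nrow x).
  move=> ef /(scale (-1)) eg; have [c cE] := add _ _ ef eg.
  by exists c => x; rewrite -cE mulN1r.
suff [c cE] : exists c, forall x : 'rV_5, minor_form gam (nrow (x *m A)) =
  quadratic c (nrow x) by exists c.
rewrite /minor_form; elim: (index_enum _) => [|m s [c cE]].
  exists (fun=> 0) => x; rewrite big_nil /quadratic big1 // => k _.
  by rewrite mul0r.
have [d dE] := add _ _ (scale (gam m) _ (diff _ _ (prod (nth (0, 0)%N minors m).1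
  (nth (0, 0)%N minors m).2.+1) (prod (nth (0, 0)%N minors m).1.+1
  (nth (0, 0)%N minors m).2))) (ex_intro _ c cE).
by exists d => x; rewrite big_cons -dE.
Qed.

Variable l : nat.
Hypothesis l_ge5 : (5 <= l)%N.

Let idx (j : nat) : 'I_l := widen_ord l_ge5 (inord (j %/ 3)).

Let weights (j : nat) : 'rV[F]_2 :=
  \row_(r < 2) (if r == 0 then (j %% 3 != 1)%N else (j %% 3 != 0)%N)%:R.

(* Two points of each of the first five lines, and their sum. *)
Let point (y : rowpair_index 4 l -> F) (j : nat) : 'rV[F]_5 :=
  weights j *m rowpair y (idx j).

(** A quadratic form on a line is determined by its values at three points, so this determinant
    tests whether some quadric contains the first five lines. *)
Let eval_mx (y : rowpair_index 4 l -> F) : 'M[F]_15 :=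
  \matrix_(k, j) (nrow (point y j) (nth (0, 0)%N monomials k).1 *
                  nrow (point y j) (nth (0, 0)%N monomials k).2).

Let eval_mxE y (v : 'rV_15) (j : 'I_15) :
  (v *m eval_mx y) 0 j = quadratic (fun k => v 0 (inord k)) (nrow (point y j)).
Proof. by rewrite mxE; apply: eq_bigr => k _; rewrite mxE inord_val. Qed.

Let det_polyfun : polyfun (fun y => \det (eval_mx y)).
Proof.
apply: polyfun_det => k j.
have pp i : polyfun (fun y => nrow (point y j) i).
  apply: (@polyfun_ext _ _ (fun y => \sum_r weights j 0 r *
      y (idx j, r, inord i))) => [y|].
    by rewrite /nrow mxE; apply: eq_bigr => r _; rewrite [rowpair _ _ _ _]mxE.
  by apply: polyfun_sum => r; apply: polyfun_mul;
    [exact: polyfun_const|exact: polyfun_coord].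
apply: (polyfun_ext _ (polyfun_mul (pp _) (pp _))) => y.
by rewrite [RHS]mxE.
Qed.

Let feasible_det (L : 'I_l -> line F 4) y :
  feasible L -> (forall a, spans (L a) (rowpair y a)) -> \det (eval_mx y) = 0.
Proof.
case=> C /rnc_pt[g gu CE] deg LN.
have /fin_all_exists[f fE] : forall a : 'I_l, exists f : 'I_4 * F * F * 'M[F]_2,
    rowpair y a = f.2 *m (chord_rows 4 f.1.1.1 f.1.1.2 f.1.2 *m g).
  move=> a; have [T [u [v [T4 uv [K KE]]]]] :=
    degree2_chord (isT : 1 < 4)%N gu CE (deg a) (LN a).
  by exists (Ordinal T4, u, v, K).
pose R (a : 'I_l) := chord_rows 4 (f a).1.1.1 (f a).1.1.2 (f a).1.2.
have [gam [[m m6 gm] gam0]] := minor_form_kernel (fun a k =>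
  nrow (row 0 (R (widen_ord l_ge5 a))) k + nrow (row 1 (R (widen_ord l_ge5 a))) k).
have [c cE] := minor_form_quadratic gam (invmx g).
have qP j : quadratic c (nrow (point y j)) = 0.
  rewrite -cE /point fE -mulmxA -mulmxA mulmxK // mulmxA mulmx_row2.
  set lam := (_ *m _) 0 0; set mu := (_ *m _) 0 1.
  have := minor_form_chord (ltn_ord (f (idx j)).1.1.1) (gam0 (inord (j %/ 3))) lam mu.
  rewrite !minor_formE /nrow !mxE; exact.
apply/eqP/det0P; exists (\row_k c k).
  apply: contraNneq gm => c0; apply/eqP; apply: (minor_form_eq0 _ m6) => z.
  rewrite -[z](mulmxK gu) cE /quadratic big1 // => k _.
  by have /rowP/(_ k) := c0; rewrite !mxE => ->; rewrite mul0r.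
apply/rowP => j; rewrite eval_mxE mxE -[RHS](qP j); apply: eq_bigr => k _.
by rewrite mxE inord_val.
Qed.

(* Supports of 0-1 vectors spanning five lines that lie on no common quadric. *)
Let supp : seq (seq nat * seq nat) := [:: ([:: 0], [:: 1]); ([:: 2], [:: 3]);
  ([:: 4], [:: 0; 2]); ([:: 1; 4], [:: 0; 3]); ([:: 1; 2], [:: 0; 3; 4])]%N.

Let y0 (t : rowpair_index 4 l) : F :=
  (val t.2 \in (if t.1.2 == 0 then (nth ([::], [::]) supp t.1.1).1
                else (nth ([::], [::]) supp t.1.1).2))%:R.

Let det_y0 : \det (eval_mx y0) != 0.
Proof.
apply/det0P => -[v v0 vE]; case/negP: v0; apply/eqP.
pose c k := v 0 (inord k).
have q0 j : (j < 15)%N -> quadratic c (fun i =>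
    (j %% 3 != 1)%N%:R * (i \in (nth ([::], [::]) supp (j %/ 3)).1)%:R +
    (j %% 3 != 0)%N%:R * (i \in (nth ([::], [::]) supp (j %/ 3)).2)%:R) = 0.
  move=> j15; have := congr1 (fun w : 'rV_15 => w 0 (Ordinal j15)) vE.
  rewrite eval_mxE [in RHS]mxE => E; rewrite -[RHS]E !quadraticE.
  have nE i : (i < 5)%N -> nrow (point y0 j) i =
      (j %% 3 != 1)%N%:R * (i \in (nth ([::], [::]) supp (j %/ 3)).1)%:R +
      (j %% 3 != 0)%N%:R * (i \in (nth ([::], [::]) supp (j %/ 3)).2)%:R.
    move=> i5; rewrite /nrow /point mxE !big_ord_recl big_ord0 addr0 !mxE /=.
    by rewrite /y0 /= !inordK // ltn_divLR.
  by rewrite /= !nE.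
have := (q0 0%N isT, q0 1%N isT, q0 2%N isT, q0 3%N isT, q0 4%N isT, q0 5%N isT,
  q0 6%N isT, q0 7%N isT, q0 8%N isT, q0 9%N isT, q0 10%N isT, q0 11%N isT,
  q0 12%N isT, q0 13%N isT, q0 14%N isT).
rewrite !quadraticE /= ?inE /=.
rewrite ?(mulr0, mul0r, mulr1, addr0, add0r).
(* Eleven equations successively kill one coefficient each; [e1] to [e4] then form a system in c 4,
   c 7, c 11 and c 13. *)
case=> [[[[[[[[[[[[[[c0 c5] c1] c9] c12] c10] c14] c2] e1] c8] c3] e2] c6] e3] e4].
rewrite ?(c0, c5, c9, c12, c14, addr0, add0r) in c1 c10 c2 c8 c3 c6 e1 e2 e3 e4.
rewrite ?(c1, c10, c2, c8, c3, c6, addr0, add0r) in e1 e2 e3 e4.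
have c7 : c 7%N = 0.
  have -> : c 7%N = (c 4%N + c 7%N + c 13%N) - (c 4%N + c 13%N) by ring.
  by rewrite e2 e3 subrr.
have c13 : c 13%N = 0.
  have -> : c 13%N = (c 4%N + c 7%N + c 11%N + c 13%N) - (c 4%N + c 11%N) - c 7%N.
    by ring.
  by rewrite e4 e1 c7 !subr0.
have c4 : c 4%N = 0 by rewrite c13 addr0 in e3.
have c11 : c 11%N = 0 by rewrite c4 add0r in e1.
apply/rowP => k; rewrite mxE -[k]inord_val -/(c k); case: k => k /=.
by do 15?[case: k => [|k] //].
Qed.

Lemma generically_infeasible_P4 :
  generically (fun L : 'I_l -> line F 4 => ~ feasible L).
Proof.
apply: (generically_of_polyfun (isT : 0 < 4)%N det_polyfun).
  by exists y0; exact: det_y0.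
by move=> y L LN /eqP hy feas; apply: hy; exact: feasible_det feas LN.
Qed.

End FiveLinesInP4.

(** * Generic feasibility *)

Section GenericFeasibility.

Variable F : numClosedFieldType.

Lemma generically_feasible n l (kappa : 'I_l * 'I_2 -> 'I_(n + 4)) :
  (1 < n)%N ->
  (forall lam, conormal (F := F) kappa lam -> forall j, lam j = 0) ->
  (forall a, kappa (a, ord0) != kappa (a, ord_max)) ->
  generically (fun L : 'I_l -> line F n => feasible L).
Proof.
move=> n1 cn kneq; have [h [ph h0 hP]] := generic_chords cn kneq.
apply: (generically_of_polyfun (ltnW n1) ph h0) => y L LN /hP[G [x [Gu xy]]].
exists (fun p => exists t (c : F), c != 0 /\ p = c *: (pt n t *m G)).
  by exists G => // p; rewrite veronese_pt.
move=> a; have [xa [K Ku KE]] := xy a.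
apply: (secant_degree2 n1 Gu _ xa) => //.
have -> : rows2 (pt n (Some (x a ord0)) *m G) (pt n (Some (x a ord_max)) *m G) =
    invmx K *m rowpair y a.
  rewrite KE -mulmxA mulKmx //; apply/matrixP => r c; rewrite mxE.
  case: (ord2_cases r) => -> /=; rewrite !mxE; apply: eq_bigr => i _.
    by rewrite !mxE.
  by rewrite !mxE; congr (x a _ ^+ i * _); apply: val_inj.
by apply: spans_mul (LN a); rewrite unitmx_inv.
Qed.

Lemma generically_feasible_matching n l : (1 < n)%N -> (2 * l <= n + 4)%N ->
  generically (fun L : 'I_l -> line F n => feasible L).
Proof.
move=> n1 ln; have lt (j : 'I_l * 'I_2) : (2 * j.1 + j.2 < n + 4)%N.
  by have := ltn_ord j.1; have := ltn_ord j.2; move: ln; clear; lia.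
pose kappa j := Ordinal (lt j).
have kinj : injective kappa.
  move=> [a r] [b s] /(congr1 val) /= E.
  have [Ea Er] : a = b :> nat /\ r = s :> nat.
    by have := ltn_ord r; have := ltn_ord s; move: E; clear; lia.
  by congr pair; apply: val_inj.
apply: (generically_feasible (kappa := kappa)) => //.
  by move=> lam; exact: conormal_matching.
by move=> a; rewrite (inj_eq kinj) xpair_eqE eqxx.
Qed.

Lemma generically_feasible_P3 l : (l <= 6)%N ->
  generically (fun L : 'I_l -> line F 3 => feasible L).
Proof.
move=> l6; apply: (@generically_feasible 3 l (@hexagon l)) => //.
  by move=> lam; exact: conormal_hexagon.
move=> a; rewrite -val_eqE /= !inordK ?(leq_trans (ltn_pmod _ _)) //=.
have := leq_trans (ltn_ord a) l6; move: (nat_of_ord a) => b.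
by do 6?[case: b => [|b] //].
Qed.

End GenericFeasibility.

Local Close Scope ring_scope.
Unset Implicit Arguments.

Theorem proposition5p2 (R : realType) (n l : nat) (hn : (3 <= n)%N) :
  ((n = 3 /\ (l <= 6)%N) \/
   ((3 < n)%N /\ (l <= n %/ 2 + 2)%N) ->
     generically (fun L : 'I_l -> line (complex R) n => feasible L))
  /\
  ((n = 3 /\ (7 <= l)%N) \/
   (n = 5 /\ (6 <= l)%N) \/
   (n = 7 /\ (7 <= l)%N) \/
   ((3 < n)%N /\ n <> 5 /\ n <> 7 /\ (n %/ 2 + 3 <= l)%N) ->
     generically (fun L : 'I_l -> line (complex R) n => ~ feasible L)).
Proof.
split=> [[[-> l6]|[n3 ln]]|cases].
- exact: generically_feasible_P3.
- apply: generically_feasible_matching; first exact: ltnW.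
  by move: ln; clear; lia.
have [n4|n4] := eqVneq n 4.
  move: cases; rewrite n4 => cases; apply: generically_infeasible_P4.
  by move: cases; clear; lia.
have [l0 ineq] : (0 < l)%N /\ (6 * l + n.+1 ^ 2 < 2 * n.+1 * l + 3)%N.
  have n4' : n <> 4 by apply/eqP.
  rewrite expnS expn1; case: cases => [[-> ?]|[[-> ?]|[[-> ?]|]]].
  - by split; lia.
  - by split; lia.
  - by split; lia.
  move=> [n3 [n5 [n7 ln]]]; split; first lia.
  (* The inequality amounts to 2 (n - 2) l > n^2 + 2 n - 2, which is monotone in [l]; the least
     admissible [l] is then treated according to the parity of [n]. *)
  have H : ((n - 2) * (n %/ 2 + 3) <= (n - 2) * l)%N by rewrite leq_mul2l ln orbT.
  suff : (n ^ 2 + 2 * n < 2 * ((n - 2) * (n %/ 2 + 3)) + 2)%N.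
    by move: H n3; clear; rewrite expnS expn1; nia.
  have := divn_eq n 2; have : (n %% 2 < 2)%N by rewrite ltn_mod.
  move: (n %/ 2)%N (n %% 2)%N => k r r2 nE; clear - nE r2 n3 n4' n5 n7.
  rewrite expnS expn1; case: r r2 nE => [|[|]] // _ nE; nia.
by apply: generically_infeasible ineq; rewrite ?(ltn_trans _ hn).
Qed.
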